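(* Let $\mathcal H$ be a Hilbert space and let $A,B$ be bounded linear operators on $\mathcal H$ such that $0<m\le A,B\le M$ for scalars $m,M$. Let $0\le r\le 1$, $0\le t\le 1$ and $\lambda=\min\{t,1-t\}$. Then \[(A\natural_t B)^r\le \min\{\kappa_1(m,M,r,t,\lambda),\kappa_2(m,M,r,t,\lambda)\}\,A^r\natural_t B^r,\] where \[\kappa_1(m,M,r,t,\lambda):=\frac{\frac{m^r\nabla_\lambda M^r}{m^r\sharp_\lambda M^r}\left(\frac{(M^r+m^r)^2}{4M^rm^r}\right)^{1+t}}{K(m,M,t)\,K^2\left(\sqrt{\frac{m^r}{M^r}},\sqrt{\frac{M^r}{m^r}},t\right)}\cdot\frac{\left(\frac{(M+m)^2}{4Mm}\right)^{r(1+t)}}{K^{2r}\left(\sqrt{\frac{m}{M}},\sqrt{\frac{M}{m}},t\right)},\] \[\kappa_2(m,M,r,t,\lambda):=\frac{\frac{m^r\nabla_\lambda M^r}{m^r\sharp_\lambda M^r}\left(\frac{(M^r+m^r)^2}{4M^rm^r}\right)^{1+t}}{K(m,M,t)\,K^2\left(\sqrt{\frac{m^r}{M^r}},\sqrt{\frac{M^r}{m^r}},t\right)}\left(\frac{(M^{1+t}+m^{1+t})^2}{4M^{1+t}m^{1+t}}\right)^r.\]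
   Context: For real scalars, $m\le A\le M$ means $mI\le A\le MI$ in the usual order on self-adjoint operators ($A\ge B$ iff $A-B$ is positive semi-definite); ''$m\le A,B\le M$'' means this holds for both $A$ and $B$. For positive definite $A,B$, $A\sharp B=A^{1/2}(A^{-1/2}BA^{-1/2})^{1/2}A^{1/2}$, and for $0\le t\le1$ the weighted spectral geometric mean is $A\natural_t B=(A^{-1}\sharp B)^{t}A(A^{-1}\sharp B)^{t}$. For positive scalars $a,b$ and $0\le\lambda\le1$, $a\nabla_\lambda b=(1-\lambda)a+\lambda b$ and $a\sharp_\lambda b=a^{1-\lambda}b^\lambda$. The generalized Kantorovich constant is, for $0<a<b$ and $t\in\mathbb R$, \[K(a,b,t)=\frac{ab^t-ba^t}{(t-1)(b-a)}\left(\frac{t-1}{t}\,\frac{b^t-a^t}{ab^t-ba^t}\right)^t,\] with the value $1$ (the limiting value) when $t\in\{0,1\}$ or $a=b$. $K^p(\cdot)$ denotes the $p$-th power of $K(\cdot)$. *)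

(* Defs.v *)
From HB Require Import structures.
From mathcomp Require Import all_boot all_order all_algebra.
From mathcomp Require Import complex.
From mathcomp Require Import all_classical all_reals all_analysis.

Set Implicit Arguments.
Unset Strict Implicit.
Unset Printing Implicit Defensive.

Import Order.TTheory GRing.Theory Num.Theory.
Import numFieldNormedType.Exports.

Local Open Scope classical_set_scope.
Local Open Scope ring_scope.
Local Open Scope complex_scope.

Section Scalars.
Context {R : realType}.
Implicit Types a b m M r t lam : R.

Definition wamean lam a b : R := (1 - lam) * a + lam * b.

Definition wgmean lam a b : R := a `^ (1 - lam) * b `^ lam.

Definition Kantorovich a b t : R :=
  if [|| t == 0, t == 1 | a == b] then 1
  else (a * b `^ t - b * a `^ t) / ((t - 1) * (b - a))
       * ((t - 1) / t * ((b `^ t - a `^ t) / (a * b `^ t - b * a `^ t))) `^ t.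

Definition kappa_common m M r t lam : R :=
  wamean lam (m `^ r) (M `^ r) / wgmean lam (m `^ r) (M `^ r)
  * ((M `^ r + m `^ r) ^+ 2 / (4 * M `^ r * m `^ r)) `^ (1 + t)
  / (Kantorovich m M t
     * Kantorovich (Num.sqrt (m `^ r / M `^ r))
                   (Num.sqrt (M `^ r / m `^ r)) t ^+ 2).

Definition kappa1 m M r t lam : R :=
  kappa_common m M r t lam
  * (((M + m) ^+ 2 / (4 * M * m)) `^ (r * (1 + t))
     / Kantorovich (Num.sqrt (m / M)) (Num.sqrt (M / m)) t `^ (2 * r)).

Definition kappa2 m M r t lam : R :=
  kappa_common m M r t lam
  * ((M `^ (1 + t) + m `^ (1 + t)) ^+ 2
     / (4 * M `^ (1 + t) * m `^ (1 + t))) `^ r.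

End Scalars.

Section Operators.
Context {R : realType} {H : completeNormedModType R[i]}.
Implicit Types (A B S T X : H -> H).

Definition bounded_op T : Prop :=
  linear T /\ exists c : R, forall x, `|T x| <= c%:C * `|x|.

Definition scalar_op (c : R) : H -> H := fun x => c%:C *: x.

(* [0 <= z] in [R[i]] forces [z] to be real, so over complex scalars this
   makes [T - S] self-adjoint as well as positive semidefinite. *)
Definition op_le (ip : {dot H for Num.conj}) S T : Prop :=
  forall x, 0 <= ip (T x - S x) x.

Definition is_op_inv T S : Prop :=
  [/\ bounded_op S, cancel T S & cancel S T].

(* Unspecified when [T] is not boundedly invertible. *)
Definition op_inv T : H -> H := get [set S | is_op_inv T S].

Definition spectrum T : set R[i] :=
  [set z | ~ exists S, is_op_inv (fun x => T x - z *: x) S].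

Definition op_poly (p : {poly R}) T : H -> H :=
  fun x => \sum_(i < size p) (p`_i)%:C *: iter i T x.

(* [X = f(T)] in the continuous functional calculus of the self-adjoint
   operator [T]: polynomials approximating [f] uniformly on the (real) spectrum
   of [T] approximate [X] in operator norm. *)
Definition is_fun_calc (f : R -> R) T X : Prop :=
  bounded_op X /\
  forall e : R, 0 < e -> exists p : {poly R},
    (forall s : R, spectrum T s%:C -> `|f s - p.[s]| <= e) /\
    (forall x, `|X x - op_poly p T x| <= e%:C * `|x|).

(* Meaningful for [T] self-adjoint and [f] continuous on its spectrum. *)
Definition fun_calc (f : R -> R) T : H -> H :=
  get [set X | is_fun_calc f T X].

Definition op_pow T (r : R) : H -> H := fun_calc (fun s => s `^ r) T.

Definition gmean A B : H -> H :=
  op_pow A (1 / 2)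
  \o op_pow (op_pow A (- (1 / 2)) \o B \o op_pow A (- (1 / 2))) (1 / 2)
  \o op_pow A (1 / 2).

Definition spectral_gmean (t : R) A B : H -> H :=
  op_pow (gmean (op_inv A) B) t \o A \o op_pow (gmean (op_inv A) B) t.

End Operators.

(* Main.v *)
(** Write [C(a,b) = (a + b)^2 / (4 a b)], [S] for the spectral geometric mean of [A] and [B], and
    [S_r] for that of [A^r] and [B^r].  With [G] the geometric mean of [A^-1] and [B] one has
    [G A G = B] and [S = G^t A G^t].  If [P] and [Q = F P F] lie between [m] and [M], then
    [(1 - t) P + t Q <= C(m,M) F^t P F^t]: the Kantorovich inequality bounds the left-hand side by
    [(M + m) |x|^2 - m M ((1 - t) <P^-1 x, x> + t <Q^-1 x, x>)], and Cauchy-Schwarz at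
    [w = (1 - t) x + t F^-1 x] together with Young's inequality [<w, F^t x> >= |x|^2] bounds the
    subtracted form below by [|x|^4 / <P F^t x, F^t x>].  For [A^r], [B^r] this gives
    [(1 - t) A^r + t B^r <= C(m^r,M^r) S_r]; for [A^-1], [B^-1], [G^-1] it gives
    [(1 - t) A^-1 + t B^-1 <= C(m,M) S^-1], whence
    [S^r <= C(m,M)^r ((1 - t) A^r + t B^r)] by monotonicity and concavity of [x^r].
    So [S^r <= C(m,M)^r C(m^r,M^r) S_r], and this constant is below [kappa1] and [kappa2] because
    Kantorovich constants with exponent in [0,1] are at most [1]. *)

Require Import Defs.
From HB Require Import structures.
From mathcomp Require Import all_boot all_order all_algebra.
From mathcomp Require Import complex.
From mathcomp Require Import all_classical all_reals all_analysis.
From mathcomp Require Import ring lra.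

Import Order.TTheory GRing.Theory Num.Theory.
Import numFieldNormedType.Exports.

Local Open Scope ring_scope.
Local Open Scope complex_scope.

(** * Scalar inequalities and Kantorovich constants *)

Section Scalars.
Context {R : realType}.
Implicit Types a b m M r t x y z e : R.

(** The congruence inequality bounds a spectral mean only from below, while the theorem needs an
    upper bound on [S]. Duality supplies it: [S^-1 = G^-t A^-1 G^-t] is again such a mean, and a
    lower bound on [S^-1] bounds [S] by a weighted harmonic mean. That is also the form in which
    powers can use it: [v / (v + s) = (1 + s v^-1)^-1], so an inequality between inverses passes to
    each such resolvent and then, by convexity of inversion, to their nonnegative combinations.
    Hence [v^r] is approximated uniformly on compact intervals of positive numbers by finite sums of
    resolvents. These sums replace the integral representation; they give monotonicity and concavity
    together and, through Neumann series, the polynomials that the functional calculus asks for. The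
    functional calculus itself rests on one fact: a real polynomial that is nonnegative on the
    spectrum has a nonnegative form. It is derived from the inversion of coercive maps, without a
    spectral theorem. *)

Lemma powR_young t x : 0 <= t <= 1 -> 0 < x -> x `^ t <= (1 - t) + t * x.
Proof.
move=> /andP[t0 t1] x0; rewrite /powR gt_eqF//.
set z := ln x; have -> : x = expR z by rewrite /z lnK.
have -> : expR z = expR (t * z) * expR ((1 - t) * z) by rewrite -expRD; congr expR; ring.
have e1 := expR_ge1Dx ((1 - t) * z); have e2 := expR_ge1Dx (- (t * z)).
have e3 : expR (t * z) * expR (- (t * z)) = 1 by rewrite -expRD subrr expR0.
have p0 : 0 < expR (t * z) by apply: expR_gt0.
(* The tangent inequalities [1 + u <= e^u] at [u = (1 - t) z] and [u = - t z], weighted by [t] and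
   [1 - t]: the terms linear in [z] cancel. *)
have : 0 <= expR (t * z) * (t * (expR ((1 - t) * z) - (1 + (1 - t) * z))
   + (1 - t) * (expR (- (t * z)) - (1 - t * z))).
  by apply: mulr_ge0; [exact: ltW | apply: addr_ge0; apply: mulr_ge0; lra].
nra.
Qed.

Lemma powR_div t a b : 0 < a -> 0 < b -> (b / a) `^ t = b `^ t / a `^ t.
Proof.
move=> a0 b0; rewrite powRM ?invr_ge0 ?ltW//; congr (_ * _).
by rewrite -(powR_inv1 (ltW a0)) -powRrM mulN1r powRN.
Qed.

Lemma mul_powR_div t a b : 0 < a -> 0 < b ->
  a * (b / a) `^ t = a `^ (1 - t) * b `^ t.
Proof.
move=> a0 b0; rewrite powR_div//.
have -> : a `^ (1 - t) = a / a `^ t.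
  by rewrite powRB ?(gt_eqF a0) ?implybT// powRr1// ltW.
by rewrite mulrCA mulrC.
Qed.

Lemma amgm_powR t a b : 0 <= t <= 1 -> 0 < a -> 0 < b ->
  a `^ (1 - t) * b `^ t <= (1 - t) * a + t * b.
Proof.
move=> t01 a0 b0; have ba0 : 0 < b / a by rewrite divr_gt0.
have := powR_young t _ t01 ba0; rewrite -(ler_pM2l a0).
rewrite mul_powR_div// => /le_trans; apply.
rewrite le_eqVlt; apply/orP; left; apply/eqP; field.
by rewrite gt_eqF.
Qed.

(** The chord of [x^t] over [[a, b]] is [nu + mu x]. With [A = nu / (1 - t)] and [B = mu / t] the
    constant is [A^(1-t) B^t], and the weighted AM-GM inequality for [A] and [B a] gives
    [A^(1-t) B^t a^t <= nu + mu a = a^t]. Positivity of [nu] is the strict growth of [x^(1-t)]. *)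
Lemma Kantorovich_gt0_le1 a b t : 0 < a -> a <= b -> 0 <= t <= 1 ->
  0 < Kantorovich a b t <= 1.
Proof.
rewrite /Kantorovich => a0; rewrite le_eqVlt => /orP[/eqP->|ab] /andP[t0 t1].
  by rewrite eqxx !orbT ltr01 lexx.
case: ifP => [_|]; first by rewrite ltr01 lexx.
move=> /negbT; rewrite !negb_or => /and3P[tn0 tn1 _].
have {}t0 : 0 < t by rewrite lt_def tn0.
have {}t1 : t < 1 by rewrite lt_def eq_sym tn1.
have b0 : 0 < b by apply: lt_trans ab.
set at_ := a `^ t; set bt := b `^ t.
have at0 : 0 < at_ by apply: powR_gt0.
have bt0 : 0 < bt by apply: powR_gt0.
have lt1 : at_ < bt by rewrite /at_ /bt gt0_ltr_powR// nnegrE ltW.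
have lt2 : a * bt < b * at_.
  have : a `^ (1 - t) < b `^ (1 - t) by rewrite gt0_ltr_powR ?nnegrE ?ltW// subr_gt0.
  have E c : 0 < c -> c `^ (1 - t) = c / c `^ t.
    by move=> c0; rewrite powRB ?(gt_eqF c0) ?implybT// powRr1// ltW.
  rewrite !E// -/at_ -/bt.
  by rewrite ltr_pdivrMr// mulrAC ltr_pdivlMr.
set nu := (b * at_ - a * bt) / (b - a); set mu := (bt - at_) / (b - a).
have nu0 : 0 < nu by rewrite divr_gt0 ?subr_gt0.
have mu0 : 0 < mu by rewrite divr_gt0 ?subr_gt0.
have ba : b - a != 0 by rewrite subr_eq0 gt_eqF.
have t1' : t - 1 != 0 by rewrite subr_eq0.
have t1'' : 1 - t != 0 by rewrite subr_eq0 eq_sym.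
have e1 : (a * bt - b * at_) / ((t - 1) * (b - a)) = nu / (1 - t).
  by rewrite /nu; field; rewrite ba t1' t1''.
have e2 : (t - 1) / t * ((bt - at_) / (a * bt - b * at_)) = (mu / t) / (nu / (1 - t)).
  rewrite /mu /nu; field; rewrite ba t1'' tn0 !subr_eq0 gt_eqF ?lt_eqF//.
rewrite e1 e2.
set A := nu / (1 - t); set B := mu / t.
have A0 : 0 < A by rewrite divr_gt0 ?subr_gt0.
have B0 : 0 < B by rewrite divr_gt0.
rewrite mul_powR_div//.
apply/andP; split; first by rewrite mulr_gt0 ?powR_gt0.
rewrite -(ler_pM2r at0) mul1r.
have := amgm_powR t A (B * a); rewrite (powRM _ (ltW B0) (ltW a0)) mulrA -/at_.
have t01 : 0 <= t <= 1 by rewrite !ltW.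
move=> /(_ t01 A0 (mulr_gt0 B0 a0))/le_trans; apply.
rewrite le_eqVlt; apply/orP; left; apply/eqP; rewrite /A /B /nu /mu; field.
by rewrite ba t1'' tn0.
Qed.


Definition kantorovich_const m M : R := (M + m) ^+ 2 / (4 * M * m).

Lemma kantorovich_const_ge1 m M : 0 < m -> 0 < M -> 1 <= kantorovich_const m M.
Proof.
move=> m0 M0; rewrite /kantorovich_const ler_pdivlMr ?mulr_gt0// mul1r.
rewrite -subr_ge0; have -> : (M + m) ^+ 2 - 4 * M * m = (M - m) ^+ 2 by ring.
exact: sqr_ge0.
Qed.

(** The constant depends only on the ratio [M / m >= 1] and grows with it; the exponent [1 + t]
    enlarges the ratio. This serves the last factor of [kappa2]. *)
Lemma le_kantorovich_const_powR t m M : 0 < m -> m <= M -> 0 <= t ->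
  kantorovich_const m M <= kantorovich_const (m `^ (1 + t)) (M `^ (1 + t)).
Proof.
move=> m0 mM t0; have M0 : 0 < M by exact: lt_le_trans mM.
have E x : 0 < x -> x `^ (1 + t) = x * x `^ t.
  by move=> x0; rewrite powRD ?(gt_eqF x0) ?implybT// powRr1// ltW.
rewrite !E// /kantorovich_const.
have : m `^ t <= M `^ t by rewrite ge0_ler_powR// nnegrE ltW.
have := powR_gt0 t m0; have := powR_gt0 t M0.
set p := m `^ t; set q := M `^ t => q0 p0 pq.
rewrite ler_pdivrMr ?mulr_gt0// mulrAC ler_pdivlMr ?mulr_gt0// -subr_ge0.
have -> : (M * q + m * p) ^+ 2 * (4 * M * m)
   - (M + m) ^+ 2 * (4 * (M * q) * (m * p)) =
   4 * M * m * ((q - p) * (M * M * q - m * m * p)) by ring.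
apply: mulr_ge0; first by rewrite !mulr_ge0// ltW.
apply: mulr_ge0; rewrite subr_ge0//.
have mmMM : m * m <= M * M by rewrite ler_pM// ltW.
by apply: ler_pM => //; [rewrite mulr_ge0// ltW | exact: ltW].
Qed.

Lemma mulr_gt0_le1 x y : 0 < x <= 1 -> 0 < y <= 1 -> 0 < x * y <= 1.
Proof.
by case/andP=> ? ? /andP[? ?]; rewrite mulr_gt0// mulr_ile1// ltW.
Qed.

(** [kappa_common] absorbs the constant of [m^r, M^r] and the remaining factor absorbs the other
    one. Whatever is left over only enlarges: the mean quotient is at least 1 by AM-GM, the exponent
    [1 + t] acts on numbers at least 1, and the denominators are at most 1. *)
Lemma kantorovich_const_le_kappa m M r t lam :
  0 < m -> m <= M -> 0 <= r <= 1 -> 0 <= t <= 1 -> lam = Num.min t (1 - t) ->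
  kantorovich_const m M `^ r * kantorovich_const (m `^ r) (M `^ r)
    <= Num.min (kappa1 m M r t lam) (kappa2 m M r t lam).
Proof.
move=> m0 mM /andP[r0 r1] t01 ->; have M0 : 0 < M by exact: lt_le_trans mM.
have /andP[t0 t1] := t01.
have l01 : 0 <= Num.min t (1 - t) <= 1.
  by rewrite le_min t0 subr_ge0 t1/= ge_min t1.
set l := Num.min _ _ in l01 *.
have mr0 : 0 < m `^ r by exact: powR_gt0.
have Mr0 : 0 < M `^ r by exact: powR_gt0.
have mMr : m `^ r <= M `^ r by rewrite ge0_ler_powR// nnegrE ltW.
have W1 : 1 <= wamean l (m `^ r) (M `^ r) / wgmean l (m `^ r) (M `^ r).
  by rewrite ler_pdivlMr ?mul1r ?amgm_powR// mulr_gt0 ?powR_gt0.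
have K01 x y : 0 < x -> x <= y ->
    0 < Kantorovich (Num.sqrt (x / y)) (Num.sqrt (y / x)) t <= 1.
  move=> x0 xy; have y0 : 0 < y by exact: lt_le_trans xy.
  apply: Kantorovich_gt0_le1 => //; first by rewrite sqrtr_gt0 divr_gt0.
  rewrite ler_wsqrtr// (@le_trans _ _ 1)//; first by rewrite ler_pdivrMr// mul1r.
  by rewrite ler_pdivlMr// mul1r.
have C1 := kantorovich_const_ge1 m M m0 M0.
have Cr1 := kantorovich_const_ge1 _ _ mr0 Mr0.
have common : kantorovich_const (m `^ r) (M `^ r) <= kappa_common m M r t l.
  rewrite /kappa_common -/(kantorovich_const _ _).
  set C := kantorovich_const _ _ in Cr1 *; set W := _ / _ in W1 *.
  have /andP[k0 k1] : 0 < Kantorovich m M t *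
     Kantorovich (Num.sqrt (m `^ r / M `^ r)) (Num.sqrt (M `^ r / m `^ r)) t ^+ 2 <= 1.
    by rewrite expr2 !mulr_gt0_le1 ?K01 ?Kantorovich_gt0_le1.
  rewrite ler_pdivlMr// (@le_trans _ _ C)//.
    by rewrite ler_piMr// (le_trans ler01).
  rewrite (@le_trans _ _ (C `^ (1 + t)))//.
    by rewrite le1r_powR// lerDl.
  by rewrite ler_peMl// powR_ge0.
have common0 : 0 <= kappa_common m M r t l.
  by apply: le_trans common; apply: le_trans Cr1.
rewrite mulrC le_min /kappa1 /kappa2; apply/andP; split; apply: ler_pM => //.
- by apply: le_trans Cr1.
- exact: powR_ge0.
- have /andP[k0 k1] := K01 _ _ m0 mM; rewrite -/(kantorovich_const _ _).
  rewrite ler_pdivlMr ?powR_gt0//.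
  apply: (@le_trans _ _ (kantorovich_const m M `^ r)).
    have E1 : 1 `^ (2 * r) = 1 :> R by rewrite powR1.
    rewrite ler_piMr ?powR_ge0// -[leRHS]E1.
    by rewrite ge0_ler_powR// ?nnegrE ?mulr_ge0// ltW.
  by rewrite ler_powR// ler_peMr// lerDl.
- by apply: le_trans Cr1.
- exact: powR_ge0.
- rewrite -/(kantorovich_const _ _) ge0_ler_powR// ?le_kantorovich_const_powR// nnegrE.
    exact: le_trans C1.
  by apply: le_trans (kantorovich_const_ge1 _ _ _ _); rewrite ?powR_gt0.
Qed.

End Scalars.

(** * Powers as uniform limits of resolvent sums *)

Section ResolventSums.
Context {R : realType}.
Implicit Types a b d e h r t x y z : R.

(* [x / (x + e^u) = x^r e^(- r u) bump r (u - ln x)]: over a fine grid of values of [u],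
   shifting by [ln x] hardly changes the sum of [bump r], so the sum of [e^(r u) x / (x + e^u)]
   is almost proportional to [x^r]. *)
Definition bump r z : R := expR (r * z) / (1 + expR z).

Let ex_gt0 z : 0 < 1 + expR z.
Proof. by rewrite addr_gt0// expR_gt0. Qed.

Lemma bump_ge0 r z : 0 <= bump r z.
Proof. by rewrite divr_ge0// ?expR_ge0// ltW. Qed.

(** The logarithmic derivative of [bump r] is [r - e^z / (1 + e^z)], which lies in [(-1, 1)]. *)
Lemma bump_shift r d h z : 0 < r < 1 -> 0 <= h <= d ->
  bump r z * expR (- d) <= bump r (z - h) <= bump r z * expR d.
Proof.
move=> /andP[r0 r1] /andP[h0 hd]; rewrite /bump.
have Eh : expR (z - h) = expR z * expR (- h) by rewrite expRD.
have Eh1 : expR (- h) <= 1 by rewrite -[leRHS]expR0 ler_expR oppr_le0.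
have -> : expR (r * (z - h)) = expR (r * z) * expR (- (r * h)).
  by rewrite -expRD; congr expR; ring.
rewrite !(mulrAC _ _^-1); apply/andP; split.
  rewrite ler_pM// ?mulr_ge0 ?expR_ge0 ?invr_ge0// ?(ltW (ex_gt0 _))//.
    by rewrite ler_pM2l ?expR_gt0// ler_expR; nra.
  by rewrite lef_pV2 ?posrE ?ex_gt0// Eh lerD2l ger_pMr ?expR_gt0.
rewrite ler_pdivrMr ?ex_gt0// (mulrAC _ _^-1) ler_pdivlMr ?ex_gt0//.
rewrite -!mulrA ler_pM2l ?expR_gt0//.
have -> : expR d * (1 + expR (z - h)) = expR d + expR (z + (d - h)).
  by rewrite mulrDr mulr1 -expRD; congr (_ + expR _); ring.
have -> : expR (- (r * h)) * (1 + expR z) = expR (- (r * h)) + expR (z - r * h).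
  by rewrite mulrDr mulr1 -expRD; congr (_ + expR _); ring.
by rewrite lerD// ler_expR; nra.
Qed.

(** [bump r z] is below [e^(r z)] and below [e^(-(1 - r) z)]; the minimum is a decay rate valid on
    both sides. *)
Lemma bump_tail r d z : 0 < r < 1 -> 0 <= d -> (z <= - d) || (d <= z) ->
  bump r z <= expR (- (Num.min r (1 - r) * d)).
Proof.
move=> /andP[r0 r1] d0 zd; rewrite /bump ler_pdivrMr ?ex_gt0// mulrDr mulr1 -expRD.
have [cr cr'] : Num.min r (1 - r) <= r /\ Num.min r (1 - r) <= 1 - r.
  by rewrite !ge_min !lexx orbT.
case/orP : zd => zd.
  apply: ler_wpDr; first exact: expR_ge0.
  by rewrite ler_expR; nra.
apply: ler_wpDl; first exact: expR_ge0.
by rewrite ler_expR; nra.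
Qed.

(** Every window shifted by [p <= 2 K] contains the same core from [2 K] to [2 N]. What it adds is
    [2 K - p] terms on the left and [p] on the right, always [2 K] tail terms, so the sum hardly
    depends on the shift. *)
Lemma sum_shift_window (F : nat -> R) (K N p : nat) (tau : R) :
  (p <= 2 * K)%N -> (K <= N)%N -> (forall n, 0 <= F n) ->
  (forall n, (n < 2 * K)%N || (2 * N < n)%N -> F n <= tau) ->
  \sum_(2 * K <= n < (2 * N).+1) F n
    <= \sum_(0 <= i < (2 * N).+1) F (i + p)%N
    <= \sum_(2 * K <= n < (2 * N).+1) F n + (2 * K)%:R * tau.
Proof.
move=> pK KN F0 Ft.
have -> : \sum_(0 <= i < (2 * N).+1) F (i + p)%N =
    \sum_(p <= n < (2 * N).+1 + p) F n.
  by rewrite -{2}[p]add0n big_addn addnK.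
have le1 : (2 * K <= (2 * N).+1)%N by rewrite leqW// leq_mul2l KN orbT.
rewrite (big_cat_nat pK)/=; last by rewrite (leq_trans le1)// leq_addr.
set S := \sum_(2 * K <= n < (2 * N).+1) F n.
rewrite (big_cat_nat le1)/= ?leq_addr// -/S.
have s0 m n : 0 <= \sum_(m <= i < n) F i by apply: sumr_ge0.
have s1 m n : (forall i, (m <= i < n)%N -> F i <= tau) ->
    \sum_(m <= i < n) F i <= (n - m)%:R * tau.
  move=> H; rewrite mulr_natl -sumr_const_nat.
  by rewrite big_nat [leRHS]big_nat; apply: ler_sum.
apply/andP; split; first by rewrite addrCA lerDl addr_ge0.
have u1 := s1 p (2 * K)%N; have u2 := s1 (2 * N).+1 ((2 * N).+1 + p)%N.
have -> : (2 * K)%:R = (2 * K - p)%:R + p%:R :> R by rewrite -natrD subnK.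
rewrite addrCA lerD2l mulrDl lerD//.
  by apply: u1 => i /andP[_ ip]; apply: Ft; rewrite ip.
by move: u2; rewrite addKn; apply => i /andP[ip _]; apply: Ft; rewrite ip orbT.
Qed.

(** A Riemann sum in [u = ln s] for the representation of [x^r] as a multiple of the integral of
    [s^(r-1) x / (x + s)] over [s > 0]. The multiple is never evaluated: dividing by [I], a sum of
    [bump] values independent of [x], normalises the sum. *)
Lemma powR_resolvent_approx r a b e : 0 < r < 1 -> 0 < a -> a <= b -> 0 < e ->
  exists (n : nat) (c s : nat -> R),
    [/\ forall i, 0 <= c i, forall i, 0 < s i &
      forall x, a <= x <= b ->
        `|x `^ r - \sum_(0 <= i < n) c i * (x / (x + s i))| <= e].
Proof.
move=> r01 a0 ab e0; have b0 : 0 < b by exact: lt_le_trans ab.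
(* The relative error will be at most [3 eps], and [x^r <= b^r]. *)
set eps := Num.min 1 (e / (3 * b `^ r)).
have br0 : 0 < b `^ r by exact: powR_gt0.
have eps0 : 0 < eps by rewrite lt_min ltr01 divr_gt0// mulr_gt0.
have eps1 : eps <= 1 by rewrite ge_min lexx.
have eps2 : eps * (3 * b `^ r) <= e.
  by rewrite -ler_pdivlMr ?mulr_gt0// ge_min lexx orbT.
set d := ln (1 + eps).
have eps10 : 0 < 1 + eps by lra.
have d0 : 0 < d by rewrite ln_gt0// ltrDl.
have Ed : expR d = 1 + eps by rewrite lnK.
have END : 1 - eps <= expR (- d).
  rewrite expRN Ed -[leRHS]mul1r ler_pdivlMr//; nra.
(* [K] grid steps cover [|ln x|] for every [x] in [[a, b]]. *)
pose K := (Num.truncn ((`|ln a| + `|ln b|) / d)).+1.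
have dK : `|ln a| + `|ln b| <= d * K%:R.
  rewrite mulrC -ler_pdivrMr//; apply: ltW; exact: truncnS_gt.
set c := Num.min r (1 - r).
have c0 : 0 < c by rewrite lt_min; case/andP: r01 => -> ?; rewrite subr_gt0.
(* [D] further steps on each side push the tails down to [2 K tau <= eps / 2], by [1 + z <= e^z]. *)
pose D := (Num.truncn ((2 * K)%:R * 2 / eps / (c * d))).+1.
pose N := (K + D)%N.
have KN : (K <= N)%N by exact: leq_addr.
pose F n := bump r (d * (n%:R - N%:R - K%:R)).
pose tau := expR (- (c * (d * D%:R))).
have F0 n : 0 <= F n by exact: bump_ge0.
have Ft n : (n < 2 * K)%N || (2 * N < n)%N -> F n <= tau.
  move=> nn; apply: bump_tail => //; first by rewrite mulr_ge0// ltW.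
  rewrite /N natrD; case/orP : nn => nn; apply/orP; [left|right].
    rewrite -mulrN ler_pM2l//.
    have : n%:R <= (2 * K)%:R :> R by rewrite ler_nat ltnW.
    by rewrite natrM; lra.
  rewrite ler_pM2l//.
  have : (2 * N)%:R <= n%:R :> R by rewrite ler_nat ltnW.
  by rewrite /N natrM natrD; lra.
have Kt : (2 * K)%:R * tau <= eps / 2.
  rewrite /tau expRN ler_pdivrMr ?expR_gt0//.
  have h1 := expR_ge1Dx (c * (d * D%:R)).
  have : (2 * K)%:R * 2 / eps / (c * d) <= D%:R by apply: ltW; exact: truncnS_gt.
  rewrite ler_pdivrMr ?mulr_gt0// ler_pdivrMr// => h2.
  by nra.
set I := \sum_(2 * K <= n < (2 * N).+1) F n.
(* The central term is [bump r 0 = 1 / 2]; this lower bound turns the absolute tail bound [eps / 2]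
   into a relative one. *)
have I12 : 1 / 2 <= I.
  have <- : F (N + K)%N = 1 / 2.
    by rewrite /F natrD (_ : _ - _ - _ = 0) ?mulr0 /bump ?mulr0 ?expR0//; ring.
  have h1 : (2 * K <= N + K)%N by rewrite mul2n -addnn leq_add2r.
  have h2 : (N + K < (2 * N).+1)%N by rewrite ltnS mul2n -addnn leq_add2l.
  rewrite /I (big_cat_nat h1)/=; last exact: ltnW.
  rewrite [X in _ <= _ + X]big_ltn// addrCA lerDl addr_ge0// sumr_ge0//.
have I0 : 0 < I by lra.
exists (2 * N).+1, (fun i => expR (r * (d * (i%:R - N%:R))) / I),
  (fun i => expR (d * (i%:R - N%:R))); split.
- by move=> i; rewrite divr_ge0 ?expR_ge0// ltW.
- by move=> i; exact: expR_gt0.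
move=> x /andP[ax xb]; have x0 : 0 < x by exact: lt_le_trans ax.
set y := ln x; have Ey : x = expR y by rewrite lnK.
have xr : x `^ r = expR (r * y) by rewrite /powR gt_eqF.
have ya : ln a <= y by rewrite ler_ln.
have yb : y <= ln b by rewrite ler_ln.
have yK : 0 <= y + d * K%:R <= d * (2 * K)%:R.
  rewrite natrM; have := ler_norm (ln b); have := ler_norm (- ln a); rewrite normrN.
  by have := normr_ge0 (ln a); have := normr_ge0 (ln b); lra.
(* [ln x] is [k - K] whole grid steps plus a remainder [h] in [[0, d]]: the steps become the index
   shift [2 K - k], and the remainder is left to [bump_shift]. *)
pose k := Num.truncn ((y + d * K%:R) / d).
have /andP[k1 k2] : k%:R <= (y + d * K%:R) / d < k.+1%:R.
  by apply: truncn_itv; rewrite divr_ge0// ?(ltW d0)//; case/andP: yK.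
have kK : (k <= 2 * K)%N.
  rewrite -(ler_nat R) (le_trans k1)// ler_pdivrMr// [leRHS]mulrC.
  by case/andP: yK.
set h := y + d * K%:R - d * k%:R.
have hd : 0 <= h <= d.
  move: k1 k2; rewrite ler_pdivlMr// ltr_pdivrMr// -natr1 /h => k1 k2; lra.
have Eterm i : expR (r * (d * (i%:R - N%:R))) / I * (x / (x + expR (d * (i%:R - N%:R))))
   = expR (r * y) / I * bump r (d * ((i + (2 * K - k))%:R - N%:R - K%:R) - h).
  have -> : d * ((i + (2 * K - k))%:R - N%:R - K%:R) - h = d * (i%:R - N%:R) - y.
    by rewrite natrD natrB// natrM /h; ring.
  set w := d * (i%:R - N%:R); rewrite /bump.
  rewrite Ey mulrBr expRB expRB; have := expR_gt0 y; have := expR_gt0 w.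
  have := expR_gt0 (r * y); move: (expR y) (expR w) (expR (r * y)) => p q s s0 q0 p0.
  by field; rewrite (gt_eqF I0) (gt_eqF s0) (gt_eqF p0) !gt_eqF// addr_gt0.
under eq_bigr do rewrite Eterm.
rewrite -mulr_sumr.
set W := \sum_(0 <= i < _) bump _ _.
have /andP[w1 w2] := sum_shift_window _ _ _ _ _ (leq_subr k (2 * K)) KN F0 Ft.
set W0 := \sum_(0 <= i < _) _ in w1 w2.
have WW0 : W0 * expR (- d) <= W <= W0 * expR d.
  rewrite /W0 /W !mulr_suml; apply/andP; split; apply: ler_sum => i _;
  by have /andP[] := bump_shift _ _ _ (d * ((i + (2 * K - k))%:R - N%:R - K%:R)) r01 hd.
have W1 : I * (1 - eps) <= W.
  case/andP: WW0 => + _; apply: le_trans; apply: ler_pM => //; first exact: ltW.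
  by rewrite subr_ge0.
(* One factor [1 + eps] comes from the tails and one from [e^d]; their product is at most
   [1 + 3 eps] because [eps <= 1]. *)
have W2 : W <= I * (1 + 3 * eps).
  case/andP: WW0 => _ /le_trans; apply; rewrite Ed.
  have W0I : W0 <= I * (1 + eps) by rewrite -/I in w2; nra.
  have : W0 * (1 + eps) <= I * (1 + eps) * (1 + eps) by rewrite ler_pM2r.
  have : 0 <= I * (eps * (1 - eps)) by rewrite !mulr_ge0 ?subr_ge0// ltW.
  by move=> p1 p2; lra.
have xb' : x `^ r <= b `^ r.
  by case/andP: r01 => r0 _; rewrite ge0_ler_powR// ?nnegrE ltW.
rewrite -xr; have -> : x `^ r - x `^ r / I * W = x `^ r * (1 - W / I) by ring.
have xr0 : 0 < x `^ r by exact: powR_gt0.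
rewrite normrM (gtr0_norm xr0) (le_trans _ eps2)// mulrC mulrA.
apply: ler_pM => //; first exact: ltW.
rewrite ler_norml; apply/andP; split.
  have : W / I <= 1 + 3 * eps by rewrite ler_pdivrMr// mulrC.
  by lra.
have : 1 - eps <= W / I by rewrite ler_pdivlMr// mulrC.
by lra.
Qed.

End ResolventSums.

(** * Polynomial approximation of real powers on an interval *)

Section PolyApprox.
Context {R : realType}.
Implicit Types a b r t x y z e : R.

Definition poly_approx a b (f : R -> R) := forall e, 0 < e ->
  exists p : {poly R}, forall s, a <= s <= b -> `|f s - p.[s]| <= e.

Lemma poly_approx_eq a b f g : {in `[a, b], f =1 g} ->
  poly_approx a b f -> poly_approx a b g.
Proof.
by move=> fg pf e /pf[p hp]; exists p => s sab; rewrite -fg ?hp.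
Qed.

Lemma poly_approx_horner a b (p : {poly R}) : poly_approx a b (horner p).
Proof. by move=> e e0; exists p => s _; rewrite subrr normr0 ltW. Qed.

Lemma poly_approx_lim a b f :
  (forall e, 0 < e -> exists2 g, poly_approx a b g &
     forall s, a <= s <= b -> `|f s - g s| <= e) -> poly_approx a b f.
Proof.
move=> H e e0; have e20 : 0 < e / 2 by lra.
have [g /(_ _ e20)[p hp] hg] := H _ e20.
exists p => s sab; rewrite (_ : f s - _ = (f s - g s) + (g s - p.[s])); last by ring.
by rewrite (le_trans (ler_normD _ _))// [e]splitr lerD ?hg ?hp.
Qed.

Lemma poly_bounded (p : {poly R}) a b :
  exists c, forall s, a <= s <= b -> `|p.[s]| <= c.
Proof.
exists (\sum_(i < size p) `|p`_i| * (`|a| + `|b|) ^+ i) => s /andP[as_ sb].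
rewrite horner_coef (le_trans (ler_norm_sum _ _ _))//; apply: ler_sum => i _.
rewrite normrM ler_wpM2l// normrX lerXn2r ?nnegrE ?addr_ge0// ler_norml.
have := ler_norm b; have := ler_norm (- a); rewrite normrN.
by have := normr_ge0 a; have := normr_ge0 b; move=> *; apply/andP; split; lra.
Qed.

Lemma poly_approx_bounded a b f : poly_approx a b f ->
  exists2 c, 0 < c & forall s, a <= s <= b -> `|f s| <= c.
Proof.
move=> /(_ 1 ltr01)[p hp]; have [c hc] := poly_bounded p a b.
exists (`|c| + 2); first by rewrite ltr_wpDl.
move=> s sab; rewrite (_ : f s = (f s - p.[s]) + p.[s]); last by ring.
rewrite (le_trans (ler_normD _ _))//.
by have := hp _ sab; have := hc _ sab; have := ler_norm c; lra.
Qed.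

Lemma poly_approxD a b f g : poly_approx a b f -> poly_approx a b g ->
  poly_approx a b (fun s => f s + g s).
Proof.
move=> pf pg e e0; have e20 : 0 < e / 2 by lra.
have [p hp] := pf _ e20; have [q hq] := pg _ e20.
exists (p + q) => s sab; rewrite hornerD.
rewrite (_ : _ - _ = (f s - p.[s]) + (g s - q.[s])); last by ring.
by rewrite (le_trans (ler_normD _ _))// [e]splitr lerD ?hp ?hq.
Qed.

Lemma poly_approxM a b f g : poly_approx a b f -> poly_approx a b g ->
  poly_approx a b (fun s => f s * g s).
Proof.
move=> pf pg e e0.
have [c c0 hc] := poly_approx_bounded _ _ _ pf.
have [d d0 hd] := poly_approx_bounded _ _ _ pg.
set e1 := Num.min 1 (e / (c + d + 1)).
have s0 : 0 < c + d + 1 by lra.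
have e10 : 0 < e1 by rewrite lt_min ltr01 divr_gt0.
have e1e : e1 * (c + d + 1) <= e by rewrite -ler_pdivlMr// ge_min lexx orbT.
have e11 : e1 <= 1 by rewrite ge_min lexx.
have [p hp] := pf _ e10; have [q hq] := pg _ e10.
exists (p * q) => s sab; rewrite hornerM.
rewrite (_ : _ - _ = f s * (g s - q.[s]) + (f s - p.[s]) * q.[s]); last by ring.
rewrite (le_trans (ler_normD _ _))// !normrM.
have hq1 : `|q.[s]| <= d + 1.
  rewrite (_ : q.[s] = g s - (g s - q.[s])); last by ring.
  by rewrite (le_trans (ler_normB _ _))// lerD ?hd// (le_trans (hq _ sab)).
rewrite (le_trans _ e1e)// mulrDr mulrDr mulr1 -addrA lerD//.
  by rewrite mulrC ler_pM ?hc ?hq.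
have -> : e1 * d + e1 = e1 * (d + 1) by ring.
by rewrite ler_pM ?hp.
Qed.

(** Neumann series: [v = (x + s) / (b + s)] lies in [(0, 1]], and truncating
    [v^-1 = sum of (1 - v)^i] after [n] terms leaves [(1 - v)^n / (x + s)], at most [k^n / (a + s)]
    with [k < 1]. *)
Lemma poly_approx_inv a b s : 0 < a + s -> a <= b ->
  poly_approx a b (fun x => (x + s)^-1).
Proof.
move=> as0 ab e e0; set L := b + s; have L0 : 0 < L by rewrite /L; lra.
set k := 1 - (a + s) / L.
have k01 : 0 <= k < 1.
  rewrite /k subr_ge0 ler_pdivrMr// mul1r lerD2r ab/=.
  by rewrite ltrBlDr ltrDl divr_gt0.
have [n hn] : exists n, k ^+ n <= e * (a + s).
  have k1 : `|k| < 1 by rewrite ger0_norm; case/andP: k01.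
  have /cvgr0Pnorm_le := cvg_expr k1; move=> /(_ _ (mulr_gt0 e0 as0))[n _ /(_ n)] H.
  by exists n; apply: le_trans (H _) => //=; rewrite ler_norm.
exists (L^-1 *: \sum_(i < n) (1 - L^-1 *: ('X + s%:P)) ^+ i) => x /andP[ax xb].
rewrite hornerZ horner_sum; under eq_bigr do rewrite horner_exp !hornerE.
have xs0 : 0 < x + s by lra.
set v := L^-1 * (x + s).
have v0 : 0 < v by rewrite mulr_gt0// invr_gt0.
have -> : (x + s)^-1 - L^-1 * \sum_(i < n) (1 - v) ^+ i = (1 - v) ^+ n / (x + s).
  have := subrX1 (1 - v) n; rewrite (_ : 1 - v - 1 = - v); last by ring.
  move=> E; have -> : (1 - v) ^+ n = 1 - v * \sum_(i < n) (1 - v) ^+ i.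
    by rewrite -[LHS](subrK 1) E; ring.
  by rewrite /v; field; rewrite !gt_eqF.
have v1 : 0 <= 1 - v by rewrite subr_ge0 /v mulrC ler_pdivrMr// mul1r lerD2r.
have vk : 1 - v <= k by rewrite /k /v lerD2l lerN2 mulrC ler_pM2l ?invr_gt0// lerD2r.
rewrite ger0_norm; last by rewrite divr_ge0 ?exprn_ge0// ltW.
rewrite ler_pdivrMr// (@le_trans _ _ (k ^+ n))//.
  by rewrite lerXn2r// nnegrE; case/andP: k01.
by rewrite (le_trans hn)// ler_pM2l// lerD2r.
Qed.

Lemma poly_approx_resolvent a b s : 0 < a -> a <= b -> 0 <= s ->
  poly_approx a b (fun x => x / (x + s)).
Proof.
move=> a0 ab s0; apply: poly_approxM.
  apply: (@poly_approx_eq _ _ (horner 'X)); last exact: poly_approx_horner.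
  by move=> x _; rewrite hornerX.
by apply: poly_approx_inv => //; lra.
Qed.

Lemma poly_approx_resolvent_sum a b n (c s : nat -> R) : 0 < a -> a <= b ->
  (forall i, 0 <= s i) ->
  poly_approx a b (fun x => \sum_(0 <= i < n) c i * (x / (x + s i))).
Proof.
move=> a0 ab s0; elim: n => [|n IH].
  apply: (@poly_approx_eq _ _ (horner 0)); last exact: poly_approx_horner.
  by move=> x _; rewrite big_geq// hornerE.
apply: (@poly_approx_eq _ _
  (fun x => \sum_(0 <= i < n) c i * (x / (x + s i)) + c n * (x / (x + s n)))).
  by move=> x _; rewrite big_nat_recr.
apply: poly_approxD => //; apply: poly_approxM; last exact: poly_approx_resolvent.
apply: (@poly_approx_eq _ _ (horner (c n)%:P)); last exact: poly_approx_horner.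
by move=> x _; rewrite hornerC.
Qed.

Lemma poly_approx_powR a b r : 0 < a -> a <= b -> -1 <= r <= 1 ->
  poly_approx a b (fun s => s `^ r).
Proof.
move=> a0 ab /andP[r0 r1].
have pos q : 0 <= q <= 1 -> poly_approx a b (fun s => s `^ q).
  case/andP; rewrite le_eqVlt => /orP[/eqP<- _|q0].
    apply: (@poly_approx_eq _ _ (horner 1)); last exact: poly_approx_horner.
    by move=> x _; rewrite hornerE powRr0.
  rewrite le_eqVlt => /orP[/eqP->|q1].
    apply: (@poly_approx_eq _ _ (horner 'X)); last exact: poly_approx_horner.
    move=> x; rewrite in_itv/= hornerX => /andP[ax _].
    by rewrite powRr1// (le_trans _ ax)// ltW.
  apply: poly_approx_lim => e e0.
  have [n [c [s [c0 s0 H]]]] := @powR_resolvent_approx _ _ _ _ _ (introT andP (conj q0 q1)) a0 ab e0.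
  exists (fun x => \sum_(0 <= i < n) c i * (x / (x + s i))) => //.
  by apply: poly_approx_resolvent_sum => // i; exact: ltW.
have [rge0|rlt0] := leP 0 r; first by apply: pos; rewrite rge0.
(* Negative exponents reduce to [x^r = x^(r+1) x^-1]; this is what limits [r] to [[-1, 1]]. *)
apply: (@poly_approx_eq _ _ (fun s => s `^ (r + 1) * (s + 0)^-1)).
  move=> x; rewrite in_itv/= addr0 => /andP[ax _].
  have x0 : 0 < x by lra.
  by rewrite -(powR_inv1 (ltW x0)) -powRD ?(gt_eqF x0) ?implybT// addrK.
apply: poly_approxM; first by apply: pos; lra.
by apply: poly_approx_inv; rewrite ?addr0.
Qed.

End PolyApprox.

(** * The real inner product *)

Section RealInnerProduct.
Context {R : realType} {H : completeNormedModType R[i]} (ip : {dot H for Num.conj}).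
Hypothesis ip_norm : forall x : H, ip x x = `|x| ^+ 2.
Implicit Types (x y z : H) (S T X Y : H -> H) (a b c e : R).

(** The real part suffices for quadratic forms and leaves the estimates to real arithmetic; complex
    scalars matter only for spectra, factorisation of polynomials and self-adjointness. *)
Definition rip x y : R := complex.Re (ip x y).
Definition nrm x : R := complex.Re `|x|.

Lemma ip_conj x y : ip x y = conjc (ip y x).
Proof. by rewrite hermC expr0 mul1r. Qed.

Lemma ripC x y : rip x y = rip y x.
Proof. by rewrite /rip ip_conj; case: (ip y x). Qed.

Lemma ripDl x y z : rip (x + y) z = rip x z + rip y z.
Proof. by rewrite /rip linearDl raddfD. Qed.

Lemma ripDr x y z : rip x (y + z) = rip x y + rip x z.
Proof. by rewrite ripC ripDl !(ripC x). Qed.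

Lemma ripZl a x y : rip (a%:C *: x) y = a * rip x y.
Proof.
by rewrite /rip linearZl_LR/=; case: (ip x y) => u v /=; rewrite mul0r subr0.
Qed.

Lemma ripZr a x y : rip x (a%:C *: y) = a * rip x y.
Proof. by rewrite ripC ripZl ripC. Qed.

Lemma ripNl x y : rip (- x) y = - rip x y.
Proof. by rewrite /rip linearNl raddfN. Qed.

Lemma ripNr x y : rip x (- y) = - rip x y.
Proof. by rewrite ripC ripNl ripC. Qed.

Lemma ripBl x y z : rip (x - y) z = rip x z - rip y z.
Proof. by rewrite ripDl ripNl. Qed.

Lemma ripBr x y z : rip x (y - z) = rip x y - rip x z.
Proof. by rewrite ripDr ripNr. Qed.

Definition ripE := (ripDl, ripDr, ripNl, ripNr, ripZl, ripZr).

Lemma rip0l x : rip 0 x = 0.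
Proof. by rewrite /rip linear0l. Qed.

Lemma normE x : `|x| = (nrm x)%:C.
Proof. by rewrite /nrm RRe_real// ger0_real. Qed.

Lemma nrm_ge0 x : 0 <= nrm x.
Proof. by have := normr_ge0 x; rewrite normE ler0c. Qed.

Lemma rip_nrm x : rip x x = nrm x ^+ 2.
Proof. by rewrite /rip ip_norm normE -rmorphXn. Qed.

Lemma rip_ge0 x : 0 <= rip x x.
Proof. by rewrite rip_nrm sqr_ge0. Qed.

Lemma nrmD x y : nrm (x + y) <= nrm x + nrm y.
Proof. by have := ler_normD x y; rewrite !normE -rmorphD lecR. Qed.

Lemma nrmN x : nrm (- x) = nrm x.
Proof. by rewrite /nrm normrN. Qed.

Lemma nrm_eq0 x : nrm x = 0 -> x = 0.
Proof. by move=> n0; apply/normr0_eq0; rewrite normE n0. Qed.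

Lemma nrm0 : nrm 0 = 0.
Proof. by rewrite /nrm normr0. Qed.

Lemma nrm_small x : (forall e, 0 < e -> nrm x <= e) -> x = 0.
Proof.
move=> hx; apply: nrm_eq0; apply: le_anti; rewrite nrm_ge0 andbT leNgt.
by apply/negP => x0; have := hx _ (divr_gt0 x0 (ltr0Sn R 1)); lra.
Qed.

(** For a complex-linear [T] this is self-adjointness for [ip]: replacing [x] by ['i *: x] recovers
    the imaginary parts. *)
Definition isym T := forall x y, rip (T x) y = rip x (T y).
Definition qle S T := forall x, rip (S x) x <= rip (T x) x.

Section LinearMaps.
Variables (T : H -> H) (lT : linear T).

Lemma linD x y : T (x + y) = T x + T y.
Proof. by have := lT 1 x y; rewrite !scale1r. Qed.

Lemma lin0 : T 0 = 0.
Proof. by apply: (addrI (T 0)); rewrite -linD !addr0. Qed.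

Lemma linZ (k : R[i]) x : T (k *: x) = k *: T x.
Proof. by have := lT k x 0; rewrite lin0 !addr0. Qed.

Lemma linN x : T (- x) = - T x.
Proof. by rewrite -scaleN1r linZ scaleN1r. Qed.

Lemma linB x y : T (x - y) = T x - T y.
Proof. by rewrite linD linN. Qed.

Lemma lin_sum n (F : 'I_n -> H) : T (\sum_i F i) = \sum_i T (F i).
Proof.
elim: n F => [|n IH] F; first by rewrite !big_ord0 lin0.
by rewrite !big_ord_recr linD IH.
Qed.

Lemma cauchy_schwarz x y : isym T -> (forall z, 0 <= rip (T z) z) ->
  rip (T x) y ^+ 2 <= rip (T x) x * rip (T y) y.
Proof.
move=> sT pT.
have key (s : R) : 0 <= s ^+ 2 * rip (T x) x + 2 * s * rip (T x) y + rip (T y) y.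
  have := pT (s%:C *: x + y); rewrite linD linZ !ripE (sT y x) (ripC y (T x)).
  by move=> h; apply: le_trans h _; rewrite le_eqVlt; apply/orP; left; apply/eqP; ring.
have xx := pT x; have yy := pT y.
set A := rip (T x) x in key xx *; set B := rip (T x) y in key *.
set C := rip (T y) y in key yy *.
have [A0|A0] := eqVneq A 0.
  rewrite A0 mul0r; have [->|B0] := eqVneq B 0; first by rewrite expr0n.
  (* With [A = 0] the form is affine in [s]; at this point it would equal [-1]. *)
  have := key (- (C + 1) / (2 * B)); rewrite A0 mulr0 add0r.
  by rewrite (_ : 2 * _ * B = - (C + 1)); [lra | field].
have {}A0 : 0 < A by rewrite lt_def A0.
have := key (- B / A).
rewrite (_ : _ + _ + _ = (A * C - B ^+ 2) / A); last by field; rewrite gt_eqF.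
by rewrite pmulr_lge0 ?invr_gt0// subr_ge0.
Qed.

End LinearMaps.

Lemma linear_id : linear (@idfun H).
Proof. by []. Qed.

Lemma rip_cauchy x y : rip x y ^+ 2 <= rip x x * rip y y.
Proof. exact: (cauchy_schwarz (@idfun H) linear_id x y (fun _ _ => erefl) rip_ge0). Qed.

Lemma rip_le x y : rip x y <= nrm x * nrm y.
Proof.
rewrite (le_trans (ler_norm _))// -(ler_pXn2r (ltn0Sn 1)) ?nnegrE ?mulr_ge0 ?nrm_ge0//.
by rewrite real_normK ?num_real// exprMn -!rip_nrm rip_cauchy.
Qed.

(** * Bounded operators, inverses and coercivity *)

Definition bnd c T := forall x, nrm (T x) <= c * nrm x.

Lemma bounded_opP T : bounded_op T <-> linear T /\ exists2 c, 0 < c & bnd c T.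
Proof.
split=> [[lT [c hc]]|[lT [c _ hc]]]; split => //.
  exists (`|c| + 1); first by rewrite ltr_wpDl.
  move=> x; have := hc x; rewrite !normE -rmorphM lecR => /le_trans; apply.
  by rewrite ler_wpM2r ?nrm_ge0// (le_trans (ler_norm _))// lerDl.
by exists c => x; rewrite !normE -rmorphM lecR.
Qed.

Lemma linear_comp S T : linear S -> linear T -> linear (S \o T).
Proof. by move=> lS lT k x y /=; rewrite lT lS. Qed.

Lemma bounded_comp S T : bounded_op S -> bounded_op T -> bounded_op (S \o T).
Proof.
move=> /bounded_opP[lS [c c0 hc]] /bounded_opP[lT [d d0 hd]].
apply/bounded_opP; split; first exact: linear_comp.
exists (c * d) => [|x]; first exact: mulr_gt0.
by rewrite (le_trans (hc _))// -mulrA ler_pM2l.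
Qed.

Lemma bounded_add S T : bounded_op S -> bounded_op T -> bounded_op (fun x => S x + T x).
Proof.
move=> /bounded_opP[lS [c c0 hc]] /bounded_opP[lT [d d0 hd]].
apply/bounded_opP; split.
  by move=> k x y; rewrite lS lT scalerDr addrACA.
exists (c + d) => [|x]; first exact: addr_gt0.
by rewrite (le_trans (nrmD _ _))// mulrDl lerD.
Qed.

Lemma bounded_scale (k : R[i]) T : bounded_op T -> bounded_op (fun x => k *: T x).
Proof.
move=> /bounded_opP[lT [c c0 hc]]; apply/bounded_opP; split.
  by move=> l x y; rewrite lT scalerDr !scalerA mulrC.
exists ((complex.Re `|k| + 1) * c) => [|x].
  by rewrite mulr_gt0// ltr_wpDl// normc_def sqrtr_ge0.
have -> : nrm (k *: T x) = complex.Re `|k| * nrm (T x).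
  rewrite {1}/nrm normrZ normE normc_def/=.
  by rewrite mulr0 subr0.
rewrite -mulrA ler_pM ?nrm_ge0// ?lerDl//.
by rewrite normc_def sqrtr_ge0.
Qed.

Lemma bounded_id : bounded_op (@idfun H).
Proof.
by apply/bounded_opP; split => //; exists 1 => // x; rewrite mul1r.
Qed.

Lemma complete_seq (u : nat -> H) (d : nat -> R) :
  (forall e, 0 < e -> exists n, d n <= e) ->
  (forall n m, (n <= m)%N -> nrm (u m - u n) <= d n) ->
  exists l, forall n, nrm (l - u n) <= d n.
Proof.
move=> d0 hu.
have cu : cvgn u.
  apply/cauchy_cvgP/cauchy_ballP => e e0.
  have e0' : 0 < complex.Re e by move: e0; rewrite ltcE => /andP[].
  have eE : e = (complex.Re e)%:C by rewrite RRe_real// gtr0_real.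
  have [n hn] := d0 _ (divr_gt0 e0' (ltr0Sn R 3)).
  have hk k : (n <= k)%N -> nrm (u k - u n) <= complex.Re e / 4.
    by move=> /hu/le_trans; apply.
  have N : (\forall k \near \oo, (n <= k)%N)%classic by exact: nbhs_infty_ge.
  near_simpl; near=> p; rewrite -ball_normE/= normE eE ltcR.
  have -> : u p.1 - u p.2 = (u p.1 - u n) - (u p.2 - u n).
    by rewrite opprB addrA subrK.
  rewrite (le_lt_trans (nrmD _ _))// nrmN.
  have p1 : nrm (u p.1 - u n) <= complex.Re e / 4.
    apply: hk; near: p; exact: (cvg_fst N).
  have p2 : nrm (u p.2 - u n) <= complex.Re e / 4.
    apply: hk; near: p; exact: (cvg_snd N).
  by lra.
exists (limn u) => n; rewrite leNgt; apply/negP => lt_d.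
have e0 : 0 < nrm (limn u - u n) - d n by rewrite subr_gt0.
have /cvgrPdist_lt/(_ (nrm (limn u - u n) - d n)%:C) := cu.
rewrite ltcR => /(_ e0)[N _ /(_ (maxn N n))]; rewrite /= leq_maxl => /(_ isT).
rewrite normE ltcR => h1.
have h2 := hu _ _ (leq_maxr N n).
have := nrmD (limn u - u (maxn N n)) (u (maxn N n) - u n).
by rewrite addrA subrK; lra.
Unshelve. all: by end_near. Qed.

Lemma is_op_inv_comp S T S' T' : is_op_inv S S' -> is_op_inv T T' ->
  is_op_inv (S \o T) (T' \o S').
Proof.
move=> [bS SK S'K] [bT TK T'K]; split; first exact: bounded_comp.
  exact: can_comp SK TK.
exact: can_comp T'K S'K.
Qed.

Lemma is_op_inv_scale (k : R[i]) T T' : k != 0 -> linear T -> is_op_inv T T' ->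
  is_op_inv (fun x => k *: T x) (fun x => k^-1 *: T' x).
Proof.
move=> k0 lT [bT' TK T'K]; have [lT' _] := bT'; split.
- exact: bounded_scale.
- by move=> x; rewrite (linZ _ lT') TK scalerK.
- by move=> x; rewrite (linZ _ lT) T'K scalerKV.
Qed.

Lemma bijective_op_inv T c : bounded_op T -> 0 < c ->
  (forall x, c * nrm x <= nrm (T x)) -> (forall y, exists x, T x = y) ->
  exists S, is_op_inv T S.
Proof.
move=> [lT _] c0 lo /choice[S hS].
have inj x y : T x = T y -> x = y.
  move=> xy; apply/eqP; rewrite -subr_eq0; apply/eqP/nrm_eq0/le_anti.
  have := lo (x - y); rewrite (linB _ lT) xy subrr nrm0 nrm_ge0 andbT.
  by rewrite pmulr_rle0.
exists S; split.
- apply/bounded_opP; split=> [k x y|].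
    by apply: inj; rewrite lT !hS.
  exists c^-1; first by rewrite invr_gt0.
  by move=> x; rewrite ler_pdivlMl// (le_trans (lo _))// hS.
- by move=> x; apply: inj; rewrite hS.
- exact: hS.
Qed.

Lemma exists_expr_le (k e : R) : 0 <= k < 1 -> 0 < e -> exists n, k ^+ n <= e.
Proof.
move=> /andP[k0 k1] e0; have k1' : `|k| < 1 by rewrite ger0_norm.
have /cvgr0Pnorm_le := cvg_expr k1'; move=> /(_ _ e0)[n _ /(_ n)] h.
by exists n; apply: le_trans (h _) => //=; rewrite ler_norm.
Qed.

(* Lax-Milgram: for small [tau], [x |-> x - tau (T x - y)] is a contraction. *)
Lemma coercive_op_inv T c : bounded_op T -> 0 < c ->
  (forall x, c * nrm x ^+ 2 <= rip (T x) x) -> exists S, is_op_inv T S.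
Proof.
move=> bT c0 co; have /bounded_opP[lT [L0 L00 hL0]] := bT.
have lo x : c * nrm x <= nrm (T x).
  have [x0|x0] := eqVneq (nrm x) 0; first by rewrite x0 mulr0 nrm_ge0.
  have {}x0 : 0 < nrm x by rewrite lt_def x0 nrm_ge0.
  by rewrite -(ler_pM2r x0) -mulrA -expr2 (le_trans (co x))// rip_le.
apply: (bijective_op_inv T c) => // y.
(* Adding [c] to the bound makes [c < L], so that the radicand in [k] is positive. *)
pose L := L0 + c; have L_gt0 : 0 < L by rewrite addr_gt0.
have hL x : nrm (T x) <= L * nrm x.
  by rewrite (le_trans (hL0 x))// ler_wpM2r ?nrm_ge0// lerDl ltW.
(* This [tau] minimises [1 - 2 tau c + tau^2 L^2], the bound on the squared contraction factor, with
   minimum [k^2]. *)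
pose tau := c / L ^+ 2; have tau0 : 0 < tau by rewrite divr_gt0// exprn_gt0.
pose Phi x := x - tau%:C *: (T x - y).
pose k := Num.sqrt (1 - c ^+ 2 / L ^+ 2).
have cL : 0 < c ^+ 2 / L ^+ 2 < 1.
  rewrite divr_gt0 ?exprn_gt0//= ltr_pdivrMr ?exprn_gt0// mul1r.
  by rewrite ltrXn2r ?nnegrE ?(ltW c0) ?(ltW L_gt0)// ltrDr.
have k01 : 0 <= k < 1.
  rewrite sqrtr_ge0/= -[ltRHS]sqrtr1 ltr_sqrt// ltrBlDr ltrDl.
  by case/andP: cL.
have k2 : k ^+ 2 = 1 - c ^+ 2 / L ^+ 2.
  by rewrite sqr_sqrtr// subr_ge0 ltW//; case/andP: cL.
have contr x z : nrm (Phi x - Phi z) <= k * nrm (x - z).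
  have -> : Phi x - Phi z = (x - z) - tau%:C *: T (x - z).
    rewrite /Phi (linB _ lT) !scalerBr; move: (tau%:C *: y) (tau%:C *: T x) (tau%:C *: T z).
    move=> p q r; rewrite (opprB q p) (opprB r p) (opprB q r) opprD opprB addrACA; congr (_ + _).
    by rewrite addrC addrA subrK.
  move: (x - z) => w; have k0 : 0 <= k by case/andP: k01.
  rewrite -(ler_pXn2r (ltn0Sn 1)) ?nnegrE ?mulr_ge0 ?nrm_ge0// exprMn k2 -!rip_nrm.
  rewrite !ripE (ripC w (T w)) rip_nrm (rip_nrm (T w)).
  have h1 := co w.
  have h2 : nrm (T w) ^+ 2 <= L ^+ 2 * nrm w ^+ 2.
    by rewrite -exprMn lerXn2r ?nnegrE ?mulr_ge0 ?nrm_ge0 ?(ltW L_gt0).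
  have t1 : tau * (c * nrm w ^+ 2) <= tau * rip (T w) w by rewrite ler_pM2l.
  have t2 : tau ^+ 2 * nrm (T w) ^+ 2 <= tau ^+ 2 * (L ^+ 2 * nrm w ^+ 2).
    by rewrite ler_pM2l// exprn_gt0.
  have e1 : tau ^+ 2 * (L ^+ 2 * nrm w ^+ 2) = c ^+ 2 / L ^+ 2 * nrm w ^+ 2.
    by rewrite /tau; field; rewrite gt_eqF.
  have e2 : tau * (c * nrm w ^+ 2) = c ^+ 2 / L ^+ 2 * nrm w ^+ 2.
    by rewrite /tau; field; rewrite gt_eqF.
  by rewrite e1 in t2; rewrite e2 in t1; lra.
pose u n := iter n Phi 0.
pose D := nrm (u 1%N - u 0%N) / (1 - k).
have [k0 k1] := andP k01.
have D0 : 0 <= D by rewrite divr_ge0 ?nrm_ge0// subr_ge0 ltW.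
have uD n : nrm (u n - u 0%N) <= D.
  elim: n => [|n IH]; first by rewrite subrr nrm0.
  have -> : u n.+1 - u 0%N = (Phi (u n) - Phi (u 0%N)) + (u 1%N - u 0%N).
    by rewrite addrA subrK.
  rewrite (le_trans (nrmD _ _))// (@le_trans _ _ (k * D + (1 - k) * D))//.
    rewrite lerD//; last by rewrite mulrC divfK// subr_eq0 gt_eqF.
    by rewrite (le_trans (contr _ _))// ler_wpM2l.
  by rewrite -mulrDl addrC subrK mul1r.
have uk n m : nrm (u (n + m)%N - u n) <= k ^+ n * D.
  elim: n => [|n IH]; first by rewrite expr0 mul1r uD.
  rewrite addSn /= (le_trans (contr _ _))// exprS -mulrA ler_wpM2l//.
have small e : 0 < e -> exists n, k ^+ n * D <= e.
  move=> e0; have [|n hn] := exists_expr_le k (e / (D + 1)) k01.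
    by rewrite divr_gt0// ltr_wpDl.
  exists n; rewrite ler_pdivlMr ?ltr_wpDl// in hn.
  by rewrite (le_trans _ hn)// ler_wpM2l ?exprn_ge0// lerDl.
have [|l hl] := complete_seq u (fun n => k ^+ n * D) small.
  by move=> n m nm; rewrite -(subnKC nm) uk.
have fix_l : Phi l - l = 0.
  apply: nrm_small => e e0; have [n hn] := small _ (divr_gt0 e0 (ltr0Sn R 1)).
  have -> : Phi l - l = (Phi l - Phi (u n)) - (l - Phi (u n)).
    by move: (Phi l) (Phi (u n)) => p q; rewrite opprB addrA subrK.
  rewrite (le_trans (nrmD _ _))// nrmN.
  have h1 := contr l (u n); have h2 := hl n; have h3 : nrm (l - Phi (u n)) <= k ^+ n.+1 * D by exact: hl n.+1.
  have h4 : k * nrm (l - u n) <= k ^+ n * D.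
    by rewrite (le_trans _ h2)// ler_piMl ?nrm_ge0// ltW.
  have h5 : k ^+ n.+1 * D <= k ^+ n * D.
    by rewrite ler_wpM2r// exprS ler_piMl ?exprn_ge0// ltW.
  by lra.
exists l; apply/eqP; rewrite -subr_eq0; apply/eqP.
move: fix_l; rewrite /Phi addrAC subrr add0r => /eqP.
rewrite oppr_eq0 scaler_eq0 => /orP[|/eqP//].
by rewrite eq_complex/= gt_eqF.
Qed.

Lemma ipZl (k : R[i]) x y : ip (k *: x) y = k * ip x y.
Proof. exact: linearZl_LR. Qed.

Lemma ipBl x y z : ip (x - y) z = ip x z - ip y z.
Proof. exact: linearBl. Qed.

Lemma rip_il x y : rip ('i *: x) y = - complex.Im (ip x y).
Proof.
by rewrite /rip linearZl_LR/=; case: (ip x y) => u v /=; rewrite mul0r add0r mul1r.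
Qed.

Lemma rip_ir x y : rip x ('i *: y) = complex.Im (ip x y).
Proof. by rewrite ripC rip_il ip_conj; case: (ip x y) => u v /=; rewrite opprK. Qed.

Lemma rip_i_self T x : linear T -> isym T -> rip ('i *: T x) x = 0.
Proof.
move=> lT sT; have := sT ('i *: x) x; rewrite (linZ _ lT) !rip_il ip_conj.
by case: (ip x (T x)) => u v /=; lra.
Qed.

(** For symmetric [T] the form of [T] is real, so multiplying [T - z] by [k], that is ['i] times the
    imaginary part of [z], leaves the real form [(Im z)^2 |x|^2], which is coercive. *)
Lemma nonreal_op_inv T (z : R[i]) : bounded_op T -> isym T -> complex.Im z != 0 ->
  exists S, is_op_inv (fun x => T x - z *: x) S.
Proof.
move=> bT sT z0; have [lT _] := bT.
have bP : bounded_op (fun x => T x - z *: x).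
  have := bounded_add _ _ bT (bounded_scale (- z) _ bounded_id).
  by under [X in bounded_op X -> _]funext do rewrite scaleNr.
pose k : R[i] := 'i * (complex.Im z)%:C.
have k0 : k != 0.
  by rewrite mulf_neq0// eq_complex/= ?oner_eq0 ?andbF// (negbTE z0).
have [|||S iS] := coercive_op_inv (fun x => k *: (T x - z *: x)) (complex.Im z ^+ 2).
- exact: bounded_scale.
- by rewrite lt_def sqr_ge0 sqrf_eq0 z0.
- move=> x; have := rip_i_self T x lT sT; rewrite rip_il => im0.
  rewrite /k -scalerA rip_il ipZl ipBl ipZl ip_norm normE -rmorphXn/=.
  move: im0; case: (ip (T x) x) => q w /= im0; case: (z) => al be /=.
  rewrite le_eqVlt; apply/orP; left; apply/eqP.
  by rewrite (_ : w = 0); [ring | lra].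
exists (fun x => S (k *: x)); have [bS SK S'K] := iS; have [lS _] := bS; split.
- have := bounded_scale k _ bS.
  by under [X in bounded_op X -> _]funext do rewrite -(linZ _ lS).
- by move=> x; rewrite SK.
- by move=> x; apply: (scalerI k0); rewrite S'K.
Qed.

Definition invertible T := exists S, is_op_inv T S.

(** * Polynomials of an operator *)

(** Complex coefficients let a polynomial of [T] be split into linear factors. *)
Definition cpoly (p : {poly R[i]}) T x := \sum_(i < size p) p`_i *: iter i T x.

Lemma op_polyE (p : {poly R}) T x : op_poly p T x = cpoly (map_poly (real_complex R) p) T x.
Proof.
by rewrite /op_poly /cpoly size_map_poly; apply: eq_bigr => i _; rewrite coef_map.
Qed.

Lemma cpoly_wide n (p : {poly R[i]}) T x : (size p <= n)%N ->
  cpoly p T x = \sum_(i < n) p`_i *: iter i T x.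
Proof.
move=> pn; rewrite /cpoly -!(big_mkord xpredT (fun i => p`_i *: iter i T x)).
rewrite [RHS](big_cat_nat (leq0n _) pn)/= [X in _ = _ + X]big_nat [X in _ = _ + X]big1 ?addr0// => i /andP[pi _].
by rewrite nth_default// scale0r.
Qed.

Lemma cpolyD p q T x : cpoly (p + q) T x = cpoly p T x + cpoly q T x.
Proof.
set n := maxn (size p) (size q).
rewrite !(cpoly_wide n) ?leq_maxl ?leq_maxr ?(leq_trans (size_polyD _ _))//.
by rewrite -big_split; apply: eq_bigr => i _; rewrite coefD scalerDl.
Qed.

Lemma cpolyC (k : R[i]) T x : cpoly k%:P T x = k *: x.
Proof.
by rewrite (cpoly_wide 1) ?size_polyC_leq1// big_ord1 coefC.
Qed.

Lemma cpolyMX p T x : linear T -> cpoly (p * 'X) T x = T (cpoly p T x).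
Proof.
move=> lT; rewrite (cpoly_wide (size p).+1) ?(leq_trans (size_polyMleq _ _)) ?size_polyX ?addn2//.
rewrite big_ord_recl coefMX eqxx scale0r add0r (lin_sum _ lT).
by apply: eq_bigr => i _; rewrite coefMX (linZ _ lT).
Qed.

Lemma cpolyM p q T x : linear T -> cpoly (p * q) T x = cpoly p T (cpoly q T x).
Proof.
move=> lT; elim/poly_ind: p => [|p c IH].
  by rewrite mul0r !cpolyC !scale0r.
rewrite mulrDl !cpolyD (mulrAC p 'X q) !cpolyMX// -IH.
congr (_ + _); rewrite cpolyC mul_polyC.
have [->|c0] := eqVneq c 0.
  by rewrite !scale0r cpolyC scale0r.
by rewrite /cpoly size_scale// scaler_sumr; apply: eq_bigr => i _; rewrite coefZ scalerA.
Qed.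

Lemma cpolyX T x : linear T -> cpoly 'X T x = T x.
Proof. by move=> lT; rewrite -['X]mul1r cpolyMX// cpolyC scale1r. Qed.

Lemma bounded_cpoly p T : bounded_op T -> bounded_op (cpoly p T).
Proof.
move=> bT; have [lT _] := bT; elim/poly_ind: p => [|p k IH].
  have -> : cpoly 0 T = (fun x => 0 *: x) by apply/funext => x; rewrite cpolyC.
  exact: bounded_scale bounded_id.
have -> : cpoly (p * 'X + k%:P) T = (fun x => T (cpoly p T x) + k *: x).
  by apply/funext => x; rewrite cpolyD cpolyMX// cpolyC.
apply: bounded_add; first exact: bounded_comp.
exact: bounded_scale bounded_id.
Qed.

Lemma cpoly_invertible (p : {poly R[i]}) T : bounded_op T -> p != 0 ->
  (forall z : R[i], root p z -> invertible (fun x => T x - z *: x)) -> invertible (cpoly p T).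
Proof.
move=> bT p0 rp; have [lT _] := bT; have [s Es] := closed_field_poly_normal p.
have l0 : lead_coef p != 0 by rewrite lead_coef_eq0.
have {}rp (z : R[i]) : z \in s -> invertible (fun x => T x - z *: x).
  by move=> zs; apply: rp; rewrite Es rootZ// root_prod_XsubC.
have [S iS] : invertible (cpoly (\prod_(z <- s) ('X - z%:P)) T).
  elim: s rp {Es} => [|z s IH] rp.
    exists idfun; rewrite big_nil; split; first exact: bounded_id.
      by move=> x; rewrite cpolyC scale1r.
    by move=> x; rewrite cpolyC scale1r.
  have [|S iS] := IH; first by move=> y ys; apply: rp; rewrite inE ys orbT.
  have [|S' iS'] := rp z; first by rewrite inE eqxx.
  exists (S \o S'); rewrite big_cons.
  under [X in is_op_inv X]funext => x do rewrite cpolyM// cpolyD -polyCN cpolyC cpolyX// scaleNr.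
  exact: is_op_inv_comp iS' iS.
exists (fun x => (lead_coef p)^-1 *: S x); rewrite {1}Es.
under [X in is_op_inv X]funext => x do rewrite -mul_polyC cpolyM// cpolyC.
apply: is_op_inv_scale => //.
by have [] := bounded_cpoly (\prod_(z <- s) ('X - z%:P)) T bT.
Qed.

Lemma op_polyD (p q : {poly R}) T x : op_poly (p + q) T x = op_poly p T x + op_poly q T x.
Proof. by rewrite !op_polyE rmorphD cpolyD. Qed.

Lemma op_polyC c T x : op_poly c%:P T x = c%:C *: x.
Proof. by rewrite op_polyE map_polyC cpolyC. Qed.

Lemma op_polyM (p q : {poly R}) T x : linear T ->
  op_poly (p * q) T x = op_poly p T (op_poly q T x).
Proof. by move=> lT; rewrite !op_polyE rmorphM cpolyM. Qed.

Lemma op_polyX T x : linear T -> op_poly 'X T x = T x.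
Proof. by move=> lT; rewrite op_polyE map_polyX cpolyX. Qed.

Lemma op_polyB (p q : {poly R}) T x : linear T ->
  op_poly (p - q) T x = op_poly p T x - op_poly q T x.
Proof.
move=> lT; rewrite op_polyD; congr (_ + _).
by rewrite -[in LHS](mul1r q) -mulNr -polyCN op_polyM// op_polyC rmorphN scaleN1r.
Qed.

Lemma bounded_op_poly p T : bounded_op T -> bounded_op (op_poly p T).
Proof.
move=> bT; have -> : op_poly p T = cpoly (map_poly (real_complex R) p) T.
  by apply/funext => x; rewrite op_polyE.
exact: bounded_cpoly.
Qed.

Lemma isym_op_poly p T : linear T -> isym T -> isym (op_poly p T).
Proof.
move=> lT sT; elim/poly_ind: p => [|p c IH] x y.
  by rewrite !op_polyC !ripZl !ripZr !mul0r.
rewrite !op_polyD !op_polyC !ripE; congr (_ + _).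
rewrite (op_polyM _ _ _ _ lT) (mulrC p) (op_polyM _ _ _ _ lT) !(op_polyX _ _ lT).
by rewrite IH sT.
Qed.

(** Cauchy-Schwarz for the form of [T] at [x] and [T x] gives [|T x|^4 <= <T x, x> c |T x|^2], hence
    [|T x|^2 <= c <T x, x>]; a bounded inverse gives [|x| <= d |T x|]. *)
Lemma invertible_coercive T : bounded_op T -> isym T -> (forall x, 0 <= rip (T x) x) ->
  invertible T -> exists2 e, 0 < e & forall x, e * nrm x ^+ 2 <= rip (T x) x.
Proof.
move=> /bounded_opP[lT [c c0 hc]] sT T0 [S [/bounded_opP[lS [d d0 hd]] TK SK]].
exists (c * d ^+ 2)^-1; first by rewrite invr_gt0 mulr_gt0// exprn_gt0.
move=> x; rewrite ler_pdivrMl ?mulr_gt0 ?exprn_gt0//.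
have h1 : nrm (T x) ^+ 2 <= c * rip (T x) x.
  have [z|z] := eqVneq (nrm (T x)) 0; first by rewrite z expr0n mulr_ge0// ltW.
  have zp : 0 < nrm (T x) ^+ 2 by rewrite exprn_gt0// lt_def z nrm_ge0.
  rewrite -(ler_pM2r zp); have := cauchy_schwarz _ lT x (T x) sT T0.
  rewrite rip_nrm -expr2 => /le_trans; apply.
  rewrite mulrAC mulrC ler_wpM2r//.
  rewrite (le_trans (rip_le _ _))// (le_trans (ler_wpM2r (nrm_ge0 _) (hc _)))//.
  by rewrite -mulrA -expr2.
have h2 : nrm x ^+ 2 <= d ^+ 2 * nrm (T x) ^+ 2.
  have := hd (T x); rewrite TK => h.
  by rewrite -exprMn lerXn2r ?nnegrE ?mulr_ge0 ?nrm_ge0 ?(ltW d0).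
rewrite (le_trans h2)//.
have -> : c * d ^+ 2 * rip (T x) x = d ^+ 2 * (c * rip (T x) x) by ring.
by rewrite ler_wpM2l// exprn_ge0// ltW.
Qed.

(* If the form of [p(T)] had infimum [c < 0], then [p(T) - c], a product of invertible factors
   [T - z] over the complex roots [z] of [p - c], would be coercive, contradicting the infimum. *)
Lemma spectrum_pos_nonconst T (p : {poly R}) : bounded_op T -> isym T -> (1 < size p)%N ->
  (forall s, spectrum T s%:C -> 0 <= p.[s]) -> forall x, 0 <= rip (op_poly p T x) x.
Proof.
move=> bT sT sp hp; have [lT _] := bT.
have bQ := bounded_op_poly p T bT; have sQ := isym_op_poly p T lT sT.
have /bounded_opP[lQ [L L0 hL]] := bQ; apply: contrapT => neg.
pose A : set R := [set c | forall x, c * nrm x ^+ 2 <= rip (op_poly p T x) x]%classic.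
have A_neg c : A c -> c < 0.
  move=> Ac; rewrite ltNge; apply/negP => c0; apply: neg => x.
  by apply: le_trans (Ac x); rewrite mulr_ge0// sqr_ge0.
have AL : A (- L).
  move=> x; have h1 := rip_le (- op_poly p T x) x.
  rewrite ripNl nrmN in h1; have h2 := ler_wpM2r (nrm_ge0 x) (hL x).
  by rewrite -mulrA -expr2 in h2; lra.
have sA : has_sup A by split; [exists (- L) | exists 0 => c /A_neg/ltW].
set c := sup A.
have Ac : A c.
  move=> x; have [x0|x0] := eqVneq (nrm x) 0.
    by rewrite (nrm_eq0 _ x0) (lin0 _ lQ) rip0l nrm0 expr0n mulr0.
  have xp : 0 < nrm x ^+ 2 by rewrite exprn_gt0// lt_def x0 nrm_ge0.
  rewrite -ler_pdivlMr//; apply: ge_sup; first by exists (- L).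
  by move=> d Ad; rewrite ler_pdivlMr.
have c0 := A_neg _ Ac.
pose q := p - c%:P.
have qE x : op_poly q T x = op_poly p T x - c%:C *: x by rewrite op_polyB// op_polyC.
(* Here [p] must be nonconstant: for the constant [p = c] there would be nothing to factor. *)
have q0 : q != 0.
  by apply/eqP => /eqP; rewrite subr_eq0 => /eqP pc; rewrite pc size_polyC in sp; case: (_ != _) sp.
have [||x||e e0 he] := invertible_coercive (op_poly q T).
- exact: bounded_op_poly.
- exact: isym_op_poly.
- by rewrite qE ripBl ripZl rip_nrm subr_ge0; exact: Ac.
- have -> : op_poly q T = cpoly (map_poly (real_complex R) q) T.
    by apply/funext => x; rewrite op_polyE.
  apply: cpoly_invertible => //; first by rewrite map_poly_eq0.
  move=> z rz; apply: contrapT => nz.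
  have [im0|im0] := eqVneq (complex.Im z) 0; last exact: nz (nonreal_op_inv _ _ bT sT im0).
  have zE : z = (complex.Re z)%:C by case: (z) im0 => a b /= ->.
  have := hp (complex.Re z); rewrite -zE => /(_ nz).
  move: rz; rewrite zE /root horner_map/= => /eqP/complexI.
  by rewrite /q hornerD hornerN hornerC; lra.
have : A (c + e).
  by move=> x; have := he x; rewrite qE ripBl ripZl rip_nrm mulrDl; lra.
by move=> /(sup_upper_bound sA); rewrite -/c; lra.
Qed.

Lemma spectrum_pos T (p : {poly R}) : bounded_op T -> isym T ->
  (forall s, spectrum T s%:C -> 0 <= p.[s]) -> forall x, 0 <= rip (op_poly p T x) x.
Proof.
move=> bT sT hp; have [sp|sp] := ltnP 1 (size p); first exact: spectrum_pos_nonconst.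
have [lT _] := bT; have := size1_polyC sp; move: (p`_0) => c pc.
rewrite pc in hp *.
have [[s hs]|ns] := pselect (exists s, spectrum T s%:C).
  move=> x; rewrite op_polyC ripZl mulr_ge0 ?rip_ge0//.
  by have := hp _ hs; rewrite hornerC.
(* An empty spectrum would make [- T ^ 2 - 1] positive. *)
have h := spectrum_pos_nonconst T (- 'X ^+ 2 - 1) bT sT.
have x0 x : x = 0.
  have : 0 <= rip (op_poly (- 'X ^+ 2 - 1) T x) x.
    apply: h; last by move=> s hs; case: ns; exists s.
    by rewrite -opprD size_polyN size_polyDl size_polyXn ?size_poly1.
  rewrite op_polyB// -polyC1 op_polyC -mulN1r -polyCN op_polyM// op_polyC expr2 op_polyM//.
  rewrite !op_polyX// !ripE sT !rip_nrm => hx.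
  apply/nrm_eq0/eqP; rewrite -sqrf_eq0; apply/eqP/le_anti; rewrite sqr_ge0 andbT.
  by have := sqr_ge0 (nrm (T x)); rewrite ?ripE in hx *; lra.
by move=> x; rewrite (x0 x) (x0 (op_poly _ _ _)) rip0l.
Qed.


(** * The functional calculus *)

Lemma norm_leE x y e : (`|x| <= e%:C * `|y|) = (nrm x <= e * nrm y).
Proof. by rewrite !normE -rmorphM lecR. Qed.

(** Positivity applied to [c^2 - p^2], whose form is [c^2 |x|^2 - |p(T) x|^2]. *)
Lemma poly_norm_le T (p : {poly R}) c : bounded_op T -> isym T -> 0 <= c ->
  (forall s, spectrum T s%:C -> `|p.[s]| <= c) ->
  forall x, nrm (op_poly p T x) <= c * nrm x.
Proof.
move=> bT sT c0 hp x; have [lT _] := bT.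
have := spectrum_pos T ((c ^+ 2)%:P - p * p) bT sT.
move=> /(_ _ x); rewrite op_polyB// op_polyC op_polyM// ripBl ripZl.
rewrite (isym_op_poly p T lT sT) !rip_nrm subr_ge0 -exprMn => h.
rewrite -(ler_pXn2r (ltn0Sn 1)) ?nnegrE ?mulr_ge0 ?nrm_ge0//; apply: h => s hs.
have := hp _ hs; rewrite hornerD hornerN hornerC hornerM subr_ge0 -expr2.
by rewrite -[X in _ -> X <= _]real_normK ?num_real// => h; rewrite lerXn2r ?nnegrE.
Qed.

Lemma is_fun_calc_uniq f T X Y : bounded_op T -> isym T ->
  is_fun_calc f T X -> is_fun_calc f T Y -> X = Y.
Proof.
move=> bT sT [bX hX] [bY hY]; have [lT _] := bT; apply/funext => x.
apply/eqP; rewrite -subr_eq0; apply/eqP/nrm_small => e e0.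
(* The three differences below cost [d], [2 d] and [d] times [|x|]. *)
have d0 : 0 < e / (4 * (nrm x + 1)).
  by rewrite divr_gt0// mulr_gt0// ltr_wpDl// nrm_ge0.
have [p [p1 p2]] := hX _ d0; have [q [q1 q2]] := hY _ d0.
set d := _ / _ in d0 p1 p2 q1 q2.
have pq s : spectrum T s%:C -> `|(p - q).[s]| <= d + d.
  move=> hs; rewrite hornerD hornerN (_ : _ - _ = (f s - q.[s]) - (f s - p.[s])).
    by rewrite (le_trans (ler_normB _ _))// lerD ?p1 ?q1.
  by ring.
have := poly_norm_le _ _ _ bT sT (ltW (addr_gt0 d0 d0)) pq x.
have := p2 x; have := q2 x; rewrite !norm_leE op_polyB//.
rewrite (_ : X x - Y x = (X x - op_poly p T x) + (op_poly p T x - op_poly q T x)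
   - (Y x - op_poly q T x)); last by rewrite addrA subrK opprB addrA subrK.
move=> h1 h2 h3; rewrite (le_trans (nrmD _ _))// nrmN.
rewrite (le_trans (lerD (nrmD _ _) (lexx _)))//.
have : d * (4 * (nrm x + 1)) = e.
  by rewrite /d divfK// gt_eqF// mulr_gt0// ltr_wpDl// nrm_ge0.
by have := nrm_ge0 x; nra.
Qed.

Definition within a b T := [/\ bounded_op T, isym T,
  forall x, a * nrm x ^+ 2 <= rip (T x) x & forall x, rip (T x) x <= b * nrm x ^+ 2].

(** For [s < a] the map [T - s] is coercive, for [s > b] its negative is; both are then boundedly
    invertible. *)
Lemma spectrum_within a b T s : within a b T -> spectrum T s%:C -> a <= s <= b.
Proof.
move=> [bT sT aT Tb] hs; apply/negPn/negP; rewrite negb_and -!ltNge => asb; apply: hs.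
have bTs : bounded_op (fun x => T x - s%:C *: x).
  have := bounded_add _ _ bT (bounded_scale (- s%:C) _ bounded_id).
  by under [X in bounded_op X -> _]funext do rewrite scaleNr.
case/orP: asb => asb.
  apply: (coercive_op_inv _ (a - s)) => //; first by rewrite subr_gt0.
  by move=> x; rewrite ripBl ripZl rip_nrm mulrBl lerD2r.
have [|||S iS] := coercive_op_inv (fun x => (- 1) *: (T x - s%:C *: x)) (s - b).
- exact: bounded_scale.
- by rewrite subr_gt0.
- by move=> x; rewrite scaleN1r ripNl ripBl ripZl rip_nrm mulrBl opprB lerD2l lerN2.
exists (fun x => S ((- 1) *: x)); have [bS SK S'K] := iS; have [lS _] := bS; split.
- have := bounded_scale (- 1) _ bS.
  by under [X in bounded_op X -> _]funext do rewrite -(linZ _ lS).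
- by move=> x; rewrite SK.
- move=> x; have n0 : - 1 != 0 :> R[i] by rewrite oppr_eq0 oner_eq0.
  by apply: (scalerI n0); exact: S'K.
Qed.

(** By [poly_norm_le], uniform approximants of [f] on [[a, b]] give operators that are Cauchy in
    norm. Their pointwise limit keeps the rate [2 * dl n], which yields linearity, boundedness and
    norm approximation. *)
Lemma is_fun_calc_exists a b f T : within a b T -> poly_approx a b f ->
  exists X, is_fun_calc f T X.
Proof.
move=> wT pf; have [bT sT _ _] := wT; have [lT _] := bT.
have [dl [pos small dl_mono]] : exists dl : nat -> R, [/\ forall n, 0 < dl n,
    forall e, 0 < e -> exists n, dl n <= e & forall n m, (n <= m)%N -> dl m <= dl n].
  exists (fun n => n.+1%:R^-1); split=> [n|e e0|n m nm]; first by rewrite invr_gt0.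
    exists (Num.truncn e^-1); rewrite invf_ple ?posrE//.
    by apply: ltW; exact: truncnS_gt.
  by rewrite lef_pV2 ?posrE// ler_nat.
have /choice[p hp] : forall n, exists p : {poly R}, forall s, a <= s <= b ->
    `|f s - p.[s]| <= dl n by move=> n; exact: pf.
have diff n m x : (n <= m)%N ->
    nrm (op_poly (p m) T x - op_poly (p n) T x) <= 2 * dl n * nrm x.
  move=> nm; rewrite -op_polyB//; apply: poly_norm_le => //.
    by rewrite mulr_ge0// ltW.
  move=> s hs; have sab := spectrum_within _ _ _ _ wT hs.
  rewrite hornerD hornerN (_ : _ - _ = (f s - (p n).[s]) - (f s - (p m).[s])); last by ring.
  rewrite (le_trans (ler_normB _ _))// mulr_natl mulr2n lerD ?hp//.
  by rewrite (le_trans (hp _ _ sab))// dl_mono.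
have /choice[X hX] : forall x, exists l, forall n,
    nrm (l - op_poly (p n) T x) <= 2 * dl n * nrm x.
  move=> x; apply: complete_seq => [e e0|n m nm]; last exact: diff.
  have d0 : 0 < e / (2 * (nrm x + 1)).
    by rewrite divr_gt0// mulr_gt0// ltr_wpDl// nrm_ge0.
  have [n] := small _ d0; rewrite ler_pdivlMr ?mulr_gt0 ?ltr_wpDl ?nrm_ge0// => hn.
  by exists n => /=; have := pos n; have := nrm_ge0 x; lra.
have lX : linear X.
  move=> k x y; apply/eqP; rewrite -subr_eq0; apply/eqP/nrm_small => e e0.
  pose N := nrm (k *: x + y) + complex.Re `|k| * nrm x + nrm y + 1.
  have k0 : 0 <= complex.Re `|k| by rewrite normc_def sqrtr_ge0.
  have N0 : 0 < N by rewrite ltr_wpDl// !addr_ge0 ?mulr_ge0 ?nrm_ge0.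
  have [n] := small _ (divr_gt0 e0 (mulr_gt0 (ltr0Sn R 1) N0)).
  rewrite ler_pdivlMr ?mulr_gt0// => hn.
  have [lP _] := bounded_op_poly (p n) T bT.
  set P := op_poly (p n) T in lP.
  have -> : X (k *: x + y) - (k *: X x + X y) =
     (X (k *: x + y) - P (k *: x + y)) - (k *: (X x - P x) + (X y - P y)).
    rewrite lP scalerBr; move: (X (k *: x + y)) (k *: X x) (X y) (k *: P x) (P y) => u1 u2 u3 u4 u5.
    by rewrite addrACA -opprD opprB [in RHS]addrA subrK.
  rewrite (le_trans (nrmD _ _))// nrmN (le_trans (lerD (lexx _) (nrmD _ _)))//.
  have h1 := hX (k *: x + y) n; have h2 := hX x n; have h3 := hX y n.
  have -> : nrm (k *: (X x - P x)) = complex.Re `|k| * nrm (X x - P x).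
    by rewrite {1}/nrm normrZ normE normc_def/= mulr0 subr0.
  have h4 := ler_wpM2l k0 h2; rewrite -/P in h1 h3 h4.
  have := pos n; rewrite /N in hn; lra.
have bX : bounded_op X.
  apply/bounded_opP; split => //; have /bounded_opP[_ [c c0 hc]] := bounded_op_poly (p 0%N) T bT.
  exists (2 * dl 0%N + c); first by rewrite addr_gt0// mulr_gt0.
  move=> x; rewrite -[X x](subrK (op_poly (p 0%N) T x)) (le_trans (nrmD _ _))//.
  by rewrite mulrDl lerD ?hc.
exists X; split => // e e0; have [n hn] := small _ (divr_gt0 e0 (ltr0Sn R 1)).
have pn := pos n.
exists (p n); split => [s hs|x].
  have sab := spectrum_within _ _ _ _ wT hs.
  by rewrite (le_trans (hp _ _ sab))//; lra.
rewrite norm_leE (le_trans (hX _ _))// ler_wpM2r ?nrm_ge0//; lra.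
Qed.

Lemma fun_calcP a b f T : within a b T -> poly_approx a b f ->
  is_fun_calc f T (fun_calc f T).
Proof. by move=> wT /(is_fun_calc_exists _ _ _ _ wT)[X hX]; exact: (@getPex _ [set X | is_fun_calc f T X]%classic (ex_intro _ X hX)). Qed.

Lemma is_fun_calcE f T X : bounded_op T -> isym T -> is_fun_calc f T X -> fun_calc f T = X.
Proof.
move=> bT sT hX; apply: (is_fun_calc_uniq f T) => //.
exact: (@getPex _ [set X | is_fun_calc f T X]%classic (ex_intro _ X hX)).
Qed.

Lemma is_fun_calc_eq f g T X : (forall s, spectrum T s%:C -> f s = g s) ->
  is_fun_calc f T X -> is_fun_calc g T X.
Proof.
move=> fg [bX hX]; split => // e /hX[p [p1 p2]]; exists p; split => // s hs.
by rewrite -fg ?p1.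
Qed.

Lemma is_fun_calc_id T : bounded_op T -> is_fun_calc id T T.
Proof.
move=> bT; have [lT _] := bT; split => // e e0; exists 'X; split => [s _|x].
  by rewrite hornerX subrr normr0 ltW.
by rewrite op_polyX// subrr normr0 mulr_ge0// ler0c ltW.
Qed.

Lemma is_fun_calc_cst c T : is_fun_calc (fun=> c) T (scalar_op c).
Proof.
split; first exact: bounded_scale bounded_id.
move=> e e0; exists c%:P; split => [s _|x].
  by rewrite hornerC subrr normr0 ltW.
by rewrite op_polyC subrr normr0 mulr_ge0// ler0c ltW.
Qed.

Lemma is_fun_calcD f g T X Y : is_fun_calc f T X -> is_fun_calc g T Y ->
  is_fun_calc (fun s => f s + g s) T (fun x => X x + Y x).
Proof.
move=> [bX hX] [bY hY]; split; first exact: bounded_add.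
move=> e e0; have e20 : 0 < e / 2 by lra.
have [p [p1 p2]] := hX _ e20; have [q [q1 q2]] := hY _ e20.
exists (p + q); split => [s hs|x].
  rewrite hornerD (_ : _ - _ = (f s - p.[s]) + (g s - q.[s])); last by ring.
  by rewrite (le_trans (ler_normD _ _))// [e]splitr lerD ?p1 ?q1.
have := p2 x; have := q2 x; rewrite !norm_leE op_polyD opprD addrACA => h1 h2.
by rewrite (le_trans (nrmD _ _))//; lra.
Qed.

Lemma is_fun_calcM a b f g T X Y : within a b T -> is_fun_calc f T X -> is_fun_calc g T Y ->
  is_fun_calc (fun s => f s * g s) T (X \o Y).
Proof.
move=> wT [bX hX] [bY hY]; split; first exact: bounded_comp.
have bd h Z : is_fun_calc h T Z -> exists2 c, 0 < c & forall s, spectrum T s%:C -> `|h s| <= c.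
  move=> [_ /(_ 1 ltr01)[p [p1 _]]]; have [c hc] := poly_bounded p a b.
  exists (`|c| + 2); first by rewrite ltr_wpDl.
  move=> s hs; have sab := spectrum_within _ _ _ _ wT hs.
  rewrite (_ : h s = (h s - p.[s]) + p.[s]); last by ring.
  rewrite (le_trans (ler_normD _ _))//.
  by have := p1 _ hs; have := hc _ sab; have := ler_norm c; lra.
have [F F0 hF] := bd _ _ (conj bX hX); have [G G0 hG] := bd _ _ (conj bY hY).
have /bounded_opP[lX [c c0 hc]] := bX; have /bounded_opP[lY [d d0 hd]] := bY.
have [[bT sT _ _] [lT _]] : within a b T /\ bounded_op T by case: (wT).
(* [s0] serves both product estimates: [F + G + 1] on the spectrum, [c + d + 1] for the
   operators. *)
move=> e e0; set s0 := F + G + 1 + (c + d + 1).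
have s00 : 0 < s0 by rewrite /s0; lra.
set e1 := Num.min 1 (e / s0).
have e10 : 0 < e1 by rewrite lt_min ltr01 divr_gt0.
have e1e : e1 * s0 <= e by rewrite -ler_pdivlMr// ge_min lexx orbT.
have e11 : e1 <= 1 by rewrite ge_min lexx.
have [p [p1 p2]] := hX _ e10; have [q [q1 q2]] := hY _ e10.
exists (p * q); split => [s hs|x].
  rewrite hornerM (_ : _ - _ = f s * (g s - q.[s]) + (f s - p.[s]) * q.[s]); last by ring.
  rewrite (le_trans (ler_normD _ _))// !normrM.
  have hq1 : `|q.[s]| <= G + 1.
    rewrite (_ : q.[s] = g s - (g s - q.[s])); last by ring.
    by rewrite (le_trans (ler_normB _ _))// lerD ?hG// (le_trans (q1 _ hs)).
  rewrite (le_trans _ e1e)// (@le_trans _ _ (F * e1 + e1 * (G + 1)))//.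
    by rewrite lerD// ler_pM ?hF ?q1 ?p1.
  by rewrite /s0; nra.
have hp := p2 (op_poly q T x); have hq := q2 x; rewrite !norm_leE in hp hq *.
rewrite op_polyM// -[X in nrm (X - _)](subrK (X (op_poly q T x))) -addrA.
rewrite (le_trans (nrmD _ _))// -(linB _ lX).
have h1 := hc (Y x - op_poly q T x).
have h2 : nrm (op_poly q T x) <= (d + 1) * nrm x.
  rewrite -[op_poly q T x](subKr (Y x)) (le_trans (nrmD _ _))// nrmN mulrDl lerD ?hd//.
  by rewrite (le_trans hq)// ler_wpM2r ?nrm_ge0.
have h3 := ler_wpM2l (ltW c0) hq; have h4 := ler_wpM2l (ltW e10) h2.
have n0 := nrm_ge0 x.
apply: (@le_trans _ _ (e1 * (c + d + 1) * nrm x)); first by rewrite /= in h1 *; lra.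
by rewrite ler_wpM2r// (le_trans _ e1e)// ler_wpM2l ?(ltW e10)// /s0; lra.
Qed.

Lemma is_fun_calc_isym f T X : bounded_op T -> isym T -> is_fun_calc f T X -> isym X.
Proof.
move=> bT sT [bX hX] x y; have [lT _] := bT.
apply/eqP; rewrite -subr_eq0; apply/eqP.
have small e : 0 < e -> `|rip (X x) y - rip x (X y)| <= e.
  move=> e0; have n0 : 0 < 2 * (nrm x * nrm y + 1).
    by rewrite mulr_gt0// ltr_wpDl// mulr_ge0 ?nrm_ge0.
  have [p [_ hp]] := hX _ (divr_gt0 e0 n0); set d := e / _ in hp.
  have dE : d * (2 * (nrm x * nrm y + 1)) = e by rewrite divfK// gt_eqF.
  have d0 : 0 < d by rewrite divr_gt0.
  have sp := isym_op_poly p T lT sT x y.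
  have hx := hp x; have hy := hp y; rewrite !norm_leE in hx hy.
  have cs u v : `|rip u v| <= nrm u * nrm v.
    by rewrite ler_norml rip_le andbT lerNl -ripNl -(nrmN u) rip_le.
  have -> : rip (X x) y - rip x (X y) =
     rip (X x - op_poly p T x) y - rip x (X y - op_poly p T y).
    by rewrite ripBl ripBr sp; ring.
  rewrite (le_trans (ler_normB _ _))// (le_trans (lerD (cs _ _) (cs _ _)))//.
  have h1 := ler_wpM2r (nrm_ge0 y) hx; have h2 := ler_wpM2l (nrm_ge0 x) hy.
  by rewrite -dE; lra.
apply/eqP; rewrite -normr_eq0 eq_le normr_ge0 andbT leNgt; apply/negP => h0.
by have := small _ (divr_gt0 h0 (ltr0Sn R 1)); lra.
Qed.

(** If [p] and [q] are [e]-close to [f] and [g], then [q - p + 2 e] is nonnegative on the spectrum,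
    so the forms can fail the inequality by at most [4 e |x|^2], less than the assumed gap. *)
Lemma is_fun_calc_le f g T X Y : bounded_op T -> isym T ->
  is_fun_calc f T X -> is_fun_calc g T Y ->
  (forall s, spectrum T s%:C -> f s <= g s) -> qle X Y.
Proof.
move=> bT sT [_ hX] [_ hY] fg x; have [lT _] := bT; rewrite leNgt; apply/negP => lt_.
have n0 : 0 < nrm x ^+ 2 + 1 by rewrite ltr_wpDl// sqr_ge0.
have e0 : 0 < (rip (X x) x - rip (Y x) x) / (4 * (nrm x ^+ 2 + 1)).
  by rewrite divr_gt0 ?subr_gt0// mulr_gt0.
have [p [p1 p2]] := hX _ e0; have [q [q1 q2]] := hY _ e0.
set e := _ / _ in e0 p1 p2 q1 q2.
have eE : e * (4 * (nrm x ^+ 2 + 1)) = rip (X x) x - rip (Y x) x.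
  by rewrite divfK// gt_eqF// mulr_gt0.
clearbody e; have := spectrum_pos T (q - p + (2 * e)%:P) bT sT; move=> /(_ _ x).
rewrite op_polyD op_polyC op_polyB// ripDl ripBl ripZl rip_nrm => h.
have {}h : 0 <= rip (op_poly q T x) x - rip (op_poly p T x) x + 2 * e * nrm x ^+ 2.
  apply: h => s hs; rewrite hornerD hornerC hornerD hornerN.
  have := p1 _ hs; have := q1 _ hs; rewrite !ler_norml => /andP[? ?] /andP[? ?].
  by have := fg _ hs; lra.
have hx := p2 x; have hy := q2 x; rewrite !norm_leE in hx hy.
have := rip_le (X x - op_poly p T x) x; have := rip_le (- (Y x - op_poly q T x)) x.
rewrite nrmN !ripNl !ripBl => h1 h2.
have h3 := ler_wpM2r (nrm_ge0 x) hx; have h4 := ler_wpM2r (nrm_ge0 x) hy.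
by rewrite -!mulrA -!expr2 in h3 h4; lra.
Qed.


(** * Powers of positive operators *)

Definition posop T := exists a b, [/\ 0 < a, a <= b & within a b T].

Lemma within_calc a b c d f T X : within a b T -> is_fun_calc f T X ->
  (forall s, a <= s <= b -> c <= f s <= d) -> within c d X.
Proof.
move=> wT hX fcd; have [bT sT _ _] := wT; split.
- by case: hX.
- exact: (is_fun_calc_isym f T).
- move=> x; have := is_fun_calc_le _ _ _ _ _ bT sT (is_fun_calc_cst c T) hX.
  rewrite /qle /scalar_op => /(_ _ x); rewrite ripZl rip_nrm; apply => s hs.
  by have /andP[] := fcd _ (spectrum_within _ _ _ _ wT hs).
- move=> x; have := is_fun_calc_le _ _ _ _ _ bT sT hX (is_fun_calc_cst d T).
  rewrite /qle /scalar_op => /(_ _ x); rewrite ripZl rip_nrm; apply => s hs.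
  by have /andP[] := fcd _ (spectrum_within _ _ _ _ wT hs).
Qed.

Lemma op_powP a b r T : 0 < a -> a <= b -> within a b T -> -1 <= r <= 1 ->
  is_fun_calc (fun s => s `^ r) T (op_pow T r).
Proof.
by move=> a0 ab wT r11; apply: (fun_calcP a b) => //; exact: poly_approx_powR.
Qed.

Lemma op_pow_within a b r T : 0 < a -> a <= b -> within a b T -> 0 <= r <= 1 ->
  within (a `^ r) (b `^ r) (op_pow T r).
Proof.
move=> a0 ab wT /andP[r0 r1]; apply: (within_calc _ _ _ _ _ _ _ wT (op_powP _ _ _ _ a0 ab wT _)).
  by lra.
move=> s /andP[as_ sb]; have s0 : 0 < s by exact: lt_le_trans as_.
by rewrite !ge0_ler_powR// nnegrE ltW// (lt_le_trans s0).
Qed.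

Lemma op_powN_within a b r T : 0 < a -> a <= b -> within a b T -> 0 <= r <= 1 ->
  within (b `^ (- r)) (a `^ (- r)) (op_pow T (- r)).
Proof.
move=> a0 ab wT /andP[r0 r1]; apply: (within_calc _ _ _ _ _ _ _ wT (op_powP _ _ _ _ a0 ab wT _)).
  by lra.
move=> s /andP[as_ sb]; have s0 : 0 < s by exact: lt_le_trans as_.
have b0 : 0 < b by exact: lt_le_trans sb.
by rewrite !powRN !lef_pV2 ?posrE ?powR_gt0// !ge0_ler_powR// nnegrE ltW.
Qed.

Lemma posop_pow r T : posop T -> -1 <= r <= 1 -> posop (op_pow T r).
Proof.
move=> [a [b [a0 ab wT]]] /andP[r0 r1]; have b0 : 0 < b by exact: lt_le_trans ab.
have [rge0|rlt0] := leP 0 r.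
  exists (a `^ r), (b `^ r); split; first exact: powR_gt0.
    by rewrite ge0_ler_powR// nnegrE ltW.
  by apply: op_pow_within => //; rewrite rge0.
have {r0 r1 rlt0}[q [q0 q1 ->]] : exists q, [/\ 0 <= q, q <= 1 & r = - q].
  by exists (- r); rewrite opprK; split => //; lra.
exists (b `^ (- q)), (a `^ (- q)); split; first exact: powR_gt0.
  by rewrite !powRN lef_pV2 ?posrE ?powR_gt0// ge0_ler_powR// nnegrE ltW.
by apply: op_powN_within => //; rewrite q0.
Qed.

Lemma posop_bounded T : posop T -> bounded_op T.
Proof. by case=> a [b [_ _ []]]. Qed.

Lemma posop_linear T : posop T -> linear T.
Proof. by move=> /posop_bounded[]. Qed.

Lemma posop_sym T : posop T -> isym T.
Proof. by case=> a [b [_ _ []]]. Qed.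

Lemma posop_ge0 T x : posop T -> 0 <= rip (T x) x.
Proof.
by case=> a [b [a0 _ [_ _ aT _]]]; rewrite (le_trans _ (aT x))// mulr_ge0 ?sqr_ge0// ltW.
Qed.

Lemma op_pow_add r s T x : posop T -> -1 <= r <= 1 -> -1 <= s <= 1 -> -1 <= r + s <= 1 ->
  op_pow T r (op_pow T s x) = op_pow T (r + s) x.
Proof.
move=> [a [b [a0 ab wT]]] hr hs hrs; have [bT sT _ _] := wT.
suff -> : op_pow T (r + s) = op_pow T r \o op_pow T s by [].
apply: (is_fun_calc_uniq (fun u : R => u `^ (r + s)) T) => //; first exact: (op_powP a b).
apply: is_fun_calc_eq (is_fun_calcM _ _ _ _ _ _ _ wT (op_powP _ _ _ _ a0 ab wT hr)
  (op_powP _ _ _ _ a0 ab wT hs)) => u hu.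
have /andP[ay _] := spectrum_within _ _ _ _ wT hu.
have u0 : u != 0 by rewrite gt_eqF// (lt_le_trans a0).
by rewrite powRD// u0 implybT.
Qed.

Lemma op_pow0 T x : posop T -> op_pow T 0 x = x.
Proof.
move=> [a [b [a0 ab wT]]]; have [bT sT _ _] := wT.
have -> : op_pow T 0 = scalar_op 1; last by rewrite /scalar_op scale1r.
apply: (is_fun_calcE _ _ _ bT sT); apply: is_fun_calc_eq (is_fun_calc_cst 1 T) => s _.
by rewrite powRr0.
Qed.

Lemma op_pow1 T : posop T -> op_pow T 1 = T.
Proof.
move=> [a [b [a0 ab wT]]]; have [bT sT _ _] := wT.
apply: (is_fun_calcE _ _ _ bT sT); apply: is_fun_calc_eq (is_fun_calc_id T bT) => s hs.
have /andP[as_ _] := spectrum_within _ _ _ _ wT hs.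
by rewrite powRr1// (le_trans _ as_)// ltW.
Qed.

Lemma op_pow_cancel r T x : posop T -> -1 <= r <= 1 -> op_pow T (- r) (op_pow T r x) = x.
Proof.
by move=> pT hr; rewrite op_pow_add ?addNr ?op_pow0//; lra.
Qed.

Lemma op_pow_inv T x : posop T -> op_pow T (-1) (T x) = x.
Proof.
by move=> pT; rewrite -{2}(op_pow1 T pT) op_pow_cancel//; lra.
Qed.

Lemma op_pow_invr T x : posop T -> T (op_pow T (-1) x) = x.
Proof.
move=> pT; rewrite -{1}(op_pow1 T pT) -[X in op_pow T X _]opprK op_pow_cancel//; lra.
Qed.

Lemma op_invE T : posop T -> op_inv T = op_pow T (-1).
Proof.
move=> pT; have iT : is_op_inv T (op_pow T (-1)).
  split; last by move=> x; exact: op_pow_invr.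
    by apply: posop_bounded; apply: posop_pow => //; lra.
  by move=> x; exact: op_pow_inv.
have [_ _ SK] := @getPex _ [set S | is_op_inv T S]%classic (ex_intro _ _ iT).
by apply/funext => x; rewrite -[LHS](op_pow_inv T _ pT) SK.
Qed.

Lemma op_powN1N1 T : posop T -> op_pow (op_pow T (-1)) (-1) = T.
Proof.
move=> pT; have pT1 : posop (op_pow T (-1)) by apply: posop_pow => //; lra.
apply/funext => x; have := op_pow_inv _ (T x) pT1.
by rewrite (op_pow_inv _ x pT).
Qed.

Lemma posop_sandwich X Z : posop X -> posop Z -> posop (Z \o X \o Z).
Proof.
move=> pX pZ; have [a [b [a0 ab [bX sX aX Xb]]]] := pX.
have [c [d [c0 cd [bZ sZ cZ Zd]]]] := pZ.
have /bounded_opP[lZ [k k0 hk]] := bZ.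
have lo x : c * nrm x <= nrm (Z x).
  have [x0|x0] := eqVneq (nrm x) 0; first by rewrite x0 mulr0 nrm_ge0.
  have {}x0 : 0 < nrm x by rewrite lt_def x0 nrm_ge0.
  by rewrite -(ler_pM2r x0) -mulrA -expr2 (le_trans (cZ x))// rip_le.
have b0 : 0 < b by exact: lt_le_trans ab.
(* The upper bound [b k^2] is enlarged so that it visibly exceeds the lower one. *)
exists (a * c ^+ 2), (a * c ^+ 2 + b * k ^+ 2); split.
- by rewrite mulr_gt0// exprn_gt0.
- by rewrite lerDl mulr_ge0 ?ltW// exprn_gt0.
split.
- by apply: bounded_comp => //; exact: bounded_comp.
- by move=> x y; rewrite /= sZ sX sZ.
- move=> x; rewrite /= sZ (le_trans _ (aX _))// -mulrA ler_wpM2l ?(ltW a0)// -exprMn.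
  by rewrite lerXn2r ?nnegrE ?mulr_ge0 ?nrm_ge0 ?(ltW c0).
- move=> x; rewrite /= sZ (le_trans (Xb _))// mulrDl ler_wpDl//.
    by apply: mulr_ge0; [apply: mulr_ge0; [exact: ltW | exact: sqr_ge0] | exact: sqr_ge0].
  rewrite -mulrA ler_wpM2l ?(ltW b0)// -exprMn.
  by rewrite lerXn2r ?nnegrE ?mulr_ge0 ?nrm_ge0 ?(ltW k0).
Qed.

(** On the spectrum this is [(M - s) (s - m) >= 0] divided by [s]. *)
Lemma kantorovich_form m M T x : 0 < m -> m <= M -> within m M T ->
  rip (T x) x + m * M * rip (op_pow T (-1) x) x <= (M + m) * nrm x ^+ 2.
Proof.
move=> m0 mM wT; have [bT sT _ _] := wT.
have c1 := is_fun_calcD _ _ _ _ _ (is_fun_calc_id T bT)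
  (is_fun_calcM _ _ _ _ _ _ _ wT (is_fun_calc_cst (m * M) T)
    (op_powP _ _ (-1) _ m0 mM wT ltac:(lra))).
have := is_fun_calc_le _ _ _ _ _ bT sT c1 (is_fun_calc_cst (M + m) T).
rewrite /qle /scalar_op/= => /(_ _ x); rewrite ripDl !ripZl rip_nrm; apply => s hs.
have /andP[ms sM] := spectrum_within _ _ _ _ wT hs.
have s0 : 0 < s by exact: lt_le_trans ms.
rewrite (powR_inv1 (ltW s0)) -subr_ge0.
have -> : M + m - (s + m * M / s) = (M - s) * (s - m) / s by field; rewrite gt_eqF.
by rewrite divr_ge0 ?mulr_ge0 ?subr_ge0// ltW.
Qed.

(** Young's inequality at [1 / s], that is [s^t ((1 - t) + t / s) >= 1]; [youngN_form] is its mirror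
    image for the dual bound. *)
Lemma young_form t T x : posop T -> 0 <= t <= 1 ->
  nrm x ^+ 2 <= rip (op_pow T t ((1 - t)%:C *: x + t%:C *: op_pow T (-1) x)) x.
Proof.
move=> [a [b [a0 ab wT]]] t01; have [bT sT _ _] := wT.
have c1 := is_fun_calcM _ _ _ _ _ _ _ wT (op_powP _ _ t _ a0 ab wT ltac:(lra))
  (is_fun_calcD _ _ _ _ _ (is_fun_calc_cst (1 - t) T)
   (is_fun_calcM _ _ _ _ _ _ _ wT (is_fun_calc_cst t T)
    (op_powP _ _ (-1) _ a0 ab wT ltac:(lra)))).
have := is_fun_calc_le _ _ _ _ _ bT sT (is_fun_calc_cst 1 T) c1.
rewrite /qle /scalar_op/= => /(_ _ x); rewrite scale1r rip_nrm; apply => s hs.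
have /andP[as_ _] := spectrum_within _ _ _ _ wT hs.
have s0 : 0 < s by exact: lt_le_trans as_.
have := powR_young t s^-1 t01; rewrite invr_gt0 => /(_ s0).
rewrite -(powR_inv1 (ltW s0)) -powRrM mulN1r powRN -[X in X <= _]mul1r ler_pdivrMr ?powR_gt0//.
by rewrite mulrC.
Qed.

Lemma youngN_form t T x : posop T -> 0 <= t <= 1 ->
  nrm x ^+ 2 <= rip (op_pow T (- t) ((1 - t)%:C *: x + t%:C *: T x)) x.
Proof.
move=> [a [b [a0 ab wT]]] t01; have [bT sT _ _] := wT.
have c1 := is_fun_calcM _ _ _ _ _ _ _ wT (op_powP _ _ (- t) _ a0 ab wT ltac:(lra))
  (is_fun_calcD _ _ _ _ _ (is_fun_calc_cst (1 - t) T)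
   (is_fun_calcM _ _ _ _ _ _ _ wT (is_fun_calc_cst t T) (is_fun_calc_id T bT))).
have := is_fun_calc_le _ _ _ _ _ bT sT (is_fun_calc_cst 1 T) c1.
rewrite /qle /scalar_op/= => /(_ _ x); rewrite scale1r rip_nrm; apply => s hs.
have /andP[as_ _] := spectrum_within _ _ _ _ wT hs.
have s0 : 0 < s by exact: lt_le_trans as_.
have := powR_young t s t01 s0.
by rewrite powRN -[X in X <= _]mul1r -ler_pdivlMr ?powR_gt0// mulrC.
Qed.

(** The origin of the constant: completing the square, [(M + m) n - m M g <= (M + m)^2 n^2 / (4 m M
    g)], and [n^2 / g <= e]. A zero [g] forces [n = 0]. *)
Lemma kantorovich_scalar (m M p g n e : R) : 0 < m -> m <= M -> 0 <= g -> 0 <= e ->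
  n ^+ 2 <= g * e -> p + m * M * g <= (M + m) * n -> p <= kantorovich_const m M * e.
Proof.
move=> m0 mM g0 e0 ne pg; have M0 : 0 < M by exact: lt_le_trans mM.
have mM0 : 0 < 4 * M * m by rewrite !mulr_gt0.
have C0 : 0 <= kantorovich_const m M by rewrite (le_trans ler01)// kantorovich_const_ge1.
have [gz|gn] := eqVneq g 0.
  have n0 : n = 0.
    by apply/eqP; rewrite -sqrf_eq0; apply/eqP/le_anti; rewrite sqr_ge0 andbT -(mul0r e) -gz.
  apply: (@le_trans _ _ 0); last exact: mulr_ge0.
  by move: pg; rewrite gz n0 !mulr0 addr0.
have {}gn : 0 < g by rewrite lt_def gn.
apply: (@le_trans _ _ ((M + m) * n - m * M * g)); first by lra.
rewrite -(ler_pM2l gn) -subr_ge0.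
have h : 0 <= kantorovich_const m M * (g * e - n ^+ 2) by rewrite mulr_ge0// subr_ge0.
have -> : g * (kantorovich_const m M * e) - g * ((M + m) * n - m * M * g) =
  kantorovich_const m M * (g * e - n ^+ 2) + ((M + m) * n - 2 * m * M * g) ^+ 2 / (4 * M * m).
  by rewrite /kantorovich_const; field; rewrite !gt_eqF.
by rewrite addr_ge0// divr_ge0 ?sqr_ge0// ltW.
Qed.

(* With [Q = F P F], [F' = F^-1] and [Y = F ^ t], the vector
   [w = (1 - t) x + t F' x] satisfies [rip w (Y x) >= |x|^2] by Young's inequality,
   so Cauchy-Schwarz for [P] bounds the form of [Y P Y] from below by that of
   [(1 - t) P^-1 + t Q^-1], which the Kantorovich inequality compares with [P] and [Q]. *)
Lemma kantorovich_congruence t m M P Q F' Y x : 0 < m -> m <= M -> 0 <= t <= 1 ->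
  within m M P -> within m M Q -> linear F' -> isym F' -> isym Y ->
  (forall x, op_pow Q (-1) x = F' (op_pow P (-1) (F' x))) ->
  (forall x, nrm x ^+ 2 <= rip (Y ((1 - t)%:C *: x + t%:C *: F' x)) x) ->
  (1 - t) * rip (P x) x + t * rip (Q x) x <= kantorovich_const m M * rip (P (Y x)) (Y x).
Proof.
move=> m0 mM /andP[t0 t1] wP wQ lF sF sY QF hY.
have pP : posop P by exists m, M.
have pPi : posop (op_pow P (-1)) by apply: posop_pow => //; lra.
have kP := kantorovich_form _ _ _ x m0 mM wP; have kQ := kantorovich_form _ _ _ x m0 mM wQ.
rewrite QF sF in kQ; set w := (1 - t)%:C *: x + t%:C *: F' x.
have lPi := posop_linear _ pPi; have sPi := posop_sym _ pPi.
set g := (1 - t) * rip (op_pow P (-1) x) x + t * rip (op_pow P (-1) (F' x)) (F' x).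
have wg : rip (op_pow P (-1) w) w <= g.
  (* Convexity of the form of [P^-1]: the defect is [t (1 - t)] times its value at [x - F' x]. *)
  have := posop_ge0 _ (x - F' x) pPi; rewrite (linB _ lPi) /w (linD _ lPi) !(linZ _ lPi) !ripE.
  rewrite (sPi x (F' x)) (ripC x) /g => h.
  have : 0 <= t * (1 - t) by rewrite mulr_ge0// subr_ge0.
  by move=> /mulr_ge0/(_ h); lra.
have e0 := posop_ge0 _ (Y x) pP; have w0 := posop_ge0 _ w pPi.
apply: (kantorovich_scalar m M _ g (nrm x ^+ 2)) => //.
- exact: le_trans wg.
- have cs := cauchy_schwarz _ (posop_linear _ pP) (op_pow P (-1) w) (Y x) (posop_sym _ pP)
    (fun z => posop_ge0 _ z pP).
  rewrite op_pow_invr// (ripC w (op_pow P (-1) w)) -sY in cs.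
  apply: (@le_trans _ _ (rip (Y w) x ^+ 2)).
    by rewrite lerXn2r ?nnegrE ?sqr_ge0// (le_trans _ (hY x))// sqr_ge0.
  by rewrite (le_trans cs)// ler_wpM2r.
- rewrite /g.
  have h1 := ler_wpM2l t0 kQ; have t1' : 0 <= 1 - t by rewrite subr_ge0.
  by have h2 := ler_wpM2l t1' kP; lra.
Qed.


(** * Joint monotonicity and concavity of powers *)

(* As [X = U^-1], [rip (X x) x] is the maximum over [w] of [2 rip w x - rip (U w) w]. *)
Lemma inverse_convex t U U1 U2 X X1 X2 : 0 <= t <= 1 ->
  linear U1 -> isym U1 -> (forall x, 0 <= rip (U1 x) x) ->
  linear U2 -> isym U2 -> (forall x, 0 <= rip (U2 x) x) ->
  (forall x, U (X x) = x) -> (forall x, U1 (X1 x) = x) -> (forall x, U2 (X2 x) = x) ->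
  (forall x, (1 - t) * rip (U1 x) x + t * rip (U2 x) x <= rip (U x) x) ->
  forall x, rip (X x) x <= (1 - t) * rip (X1 x) x + t * rip (X2 x) x.
Proof.
move=> /andP[t0 t1] l1 s1 p1 l2 s2 p2 UX UX1 UX2 hU x; set w := X x.
have var V Y : linear V -> isym V -> (forall x, 0 <= rip (V x) x) ->
    (forall x, V (Y x) = x) -> 2 * rip w x - rip (V w) w <= rip (Y x) x.
  move=> lV sV pV VY; have := pV (w - Y x).
  rewrite (linB _ lV) VY !ripBl !ripBr (sV w (Y x)) VY (ripC x w) (ripC x (Y x)); lra.
have h1 := var _ _ l1 s1 p1 UX1; have h2 := var _ _ l2 s2 p2 UX2; have := hU w.
rewrite {3}/w UX (ripC x w).
have t1' : 0 <= 1 - t by rewrite subr_ge0.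
by have := ler_wpM2l t0 h2; have := ler_wpM2l t1' h1; lra.
Qed.

(** [f(P) <= (1 - t) f(c Q1) + t f(c Q2)] as forms. The factor [c] sits in the function, so no
    functional calculus of a rescaled operator is needed. *)
Definition concave_at t c P Q1 Q2 (f : R -> R) := exists X X1 X2,
  [/\ is_fun_calc f P X, is_fun_calc (fun s => f (c * s)) Q1 X1,
      is_fun_calc (fun s => f (c * s)) Q2 X2 &
      forall x, rip (X x) x <= (1 - t) * rip (X1 x) x + t * rip (X2 x) x].

Section Concavity.
Variables (t c : R) (P Q1 Q2 : H -> H).
Hypotheses (t01 : 0 <= t <= 1) (c0 : 0 < c).
Hypotheses (pP : posop P) (pQ1 : posop Q1) (pQ2 : posop Q2).
Hypothesis hyp : forall x,
  (1 - t) * rip (op_pow Q1 (-1) x) x + t * rip (op_pow Q2 (-1) x) x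
    <= c * rip (op_pow P (-1) x) x.

Lemma resolvent_calc (s k : R) T : posop T -> 0 < s -> 0 < k ->
  exists2 X, is_fun_calc (fun v : R => k * v / (k * v + s)) T X &
    forall x, X x + (s / k)%:C *: op_pow T (-1) (X x) = x.
Proof.
move=> [a [b [a0 ab wT]]] s0 k0; have [bT sT _ _] := wT.
have sk : 0 < s / k by rewrite divr_gt0.
have [X0 hX0] := is_fun_calc_exists _ _ _ _ wT (poly_approx_resolvent _ _ _ a0 ab (ltW sk)).
have Tpos u : spectrum T u%:C -> 0 < u.
  by move=> hu; have /andP[+ _] := spectrum_within _ _ _ _ wT hu; exact: lt_le_trans.
have hX : is_fun_calc (fun v : R => k * v / (k * v + s)) T X0.
  apply: is_fun_calc_eq hX0 => u /Tpos u0; field.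
  by rewrite !gt_eqF ?addr_gt0 ?mulr_gt0.
exists X0 => // x.
have c1 := is_fun_calcM _ _ _ _ _ _ _ wT
  (is_fun_calcD _ _ _ _ _ (is_fun_calc_cst 1 T)
    (is_fun_calcM _ _ _ _ _ _ _ wT (is_fun_calc_cst (s / k) T)
      (op_powP _ _ (-1) _ a0 ab wT ltac:(lra)))) hX0.
have c2 : is_fun_calc (fun=> 1) T
    ((fun x => scalar_op 1 x + (scalar_op (s / k) \o op_pow T (-1)) x) \o X0).
  apply: is_fun_calc_eq c1 => u /Tpos u0; rewrite (powR_inv1 (ltW u0)); field.
  by rewrite !gt_eqF ?addr_gt0 ?mulr_gt0.
have E := is_fun_calc_uniq _ _ _ _ bT sT (is_fun_calc_cst 1 T) c2.
rewrite -[RHS]scale1r -[RHS]/(scalar_op 1 x) E.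
by rewrite /= /scalar_op scale1r.
Qed.

(** [c v / (c v + s)] is the inverse of [1 + (s / c) v^-1]. Scaling [hyp] by [s / c] and adding
    [|x|^2] compares these denominators at [Q1], [Q2] with [1 + s v^-1] at [P], and [inverse_convex]
    inverts the comparison. *)
Lemma concave_at_resolvent s : 0 < s -> concave_at t c P Q1 Q2 (fun v : R => v / (v + s)).
Proof.
move=> s0.
have [X hX X_inv] := resolvent_calc s 1 P pP s0 ltr01.
have [X1 hX1 X1_inv] := resolvent_calc s c Q1 pQ1 s0 c0.
have [X2 hX2 X2_inv] := resolvent_calc s c Q2 pQ2 s0 c0.
exists X, X1, X2; split => //.
  by apply: is_fun_calc_eq hX => u _; rewrite mul1r.
have lin k T : posop T -> linear (fun x => x + k%:C *: op_pow T (-1) x).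
  move=> pT l x y; have lTi := posop_linear _ (posop_pow (-1) _ pT ltac:(lra)).
  by rewrite lTi !scalerDr !scalerA (mulrC l) addrACA.
have sym k T : posop T -> isym (fun x => x + k%:C *: op_pow T (-1) x).
  move=> pT x y; have sTi := posop_sym _ (posop_pow (-1) _ pT ltac:(lra)).
  by rewrite !ripE sTi.
have pos k T : 0 <= k -> posop T -> forall x, 0 <= rip (x + k%:C *: op_pow T (-1) x) x.
  move=> k0 pT x; have := posop_ge0 _ x (posop_pow (-1) _ pT ltac:(lra)) => h.
  by rewrite !ripE addr_ge0 ?rip_ge0// mulr_ge0.
have sc : 0 <= s / c by rewrite divr_ge0 ?ltW.
pose U k T x := x + k%:C *: op_pow T (-1) x.
apply: (inverse_convex t (U (s / 1) P) (U (s / c) Q1) (U (s / c) Q2) X X1 X2 t01 (lin _ _ pQ1) (sym _ _ pQ1) (pos _ _ sc pQ1)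
  (lin _ _ pQ2) (sym _ _ pQ2) (pos _ _ sc pQ2) X_inv X1_inv X2_inv) => x.
rewrite /U !ripE divr1; have := ler_wpM2l sc (hyp x).
rewrite [X in _ <= X]mulrA divfK ?gt_eqF// => h; lra.
Qed.

Lemma concave_at_sum n (k s : nat -> R) : (forall i, 0 <= k i) -> (forall i, 0 < s i) ->
  concave_at t c P Q1 Q2 (fun v : R => \sum_(0 <= i < n) k i * (v / (v + s i))).
Proof.
move=> k0 s0; elim: n => [|n [X [X1 [X2 [hX hX1 hX2 h]]]]].
  exists (scalar_op 0), (scalar_op 0), (scalar_op 0); split.
  - by apply: is_fun_calc_eq (is_fun_calc_cst 0 P) => u _; rewrite big_geq.
  - by apply: is_fun_calc_eq (is_fun_calc_cst 0 Q1) => u _; rewrite big_geq.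
  - by apply: is_fun_calc_eq (is_fun_calc_cst 0 Q2) => u _; rewrite big_geq.
  - by move=> x; rewrite /scalar_op !ripZl !mul0r !mulr0 addr0.
have [Y [Y1 [Y2 [hY hY1 hY2 hy]]]] := concave_at_resolvent _ (s0 n).
have add T Z W (g : R -> R) : posop T ->
    is_fun_calc (fun v : R => \sum_(0 <= i < n) k i * (g v / (g v + s i))) T Z ->
    is_fun_calc (fun v : R => g v / (g v + s n)) T W ->
    is_fun_calc (fun v : R => \sum_(0 <= i < n.+1) k i * (g v / (g v + s i))) T
      (fun x => Z x + (scalar_op (k n) \o W) x).
  move=> [a [b [a0 ab wT]]] hZ hW.
  apply: is_fun_calc_eq (is_fun_calcD _ _ _ _ _ hZ
    (is_fun_calcM _ _ _ _ _ _ _ wT (is_fun_calc_cst (k n) T) hW)) => u _.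
  by rewrite big_nat_recr.
exists (fun x => X x + (scalar_op (k n) \o Y) x), (fun x => X1 x + (scalar_op (k n) \o Y1) x),
  (fun x => X2 x + (scalar_op (k n) \o Y2) x); split.
- exact: (add P X Y id).
- exact: (add Q1 X1 Y1 (fun v : R => c * v)).
- exact: (add Q2 X2 Y2 (fun v : R => c * v)).
- move=> x; rewrite /scalar_op/= !ripDl !ripZl.
  by have := h x; have := ler_wpM2l (k0 n) (hy x); lra.
Qed.

Lemma powR_monotone_concave r x : 0 <= r <= 1 ->
  rip (op_pow P r x) x <=
  c `^ r * ((1 - t) * rip (op_pow Q1 r x) x + t * rip (op_pow Q2 r x) x).
Proof.
case/andP; rewrite le_eqVlt => /orP[/eqP<- _|r0].
  by rewrite powRr0 mul1r !op_pow0// -mulrDl subrK mul1r.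
(* The resolvent sums need [0 < r < 1]; at [r = 1] inverting [hyp] itself is enough. *)
rewrite le_eqVlt => /orP[/eqP->|r1].
  rewrite (powRr1 (ltW c0)) !op_pow1//.
  have -> : c * ((1 - t) * rip (Q1 x) x + t * rip (Q2 x) x) =
     (1 - t) * rip (c%:C *: Q1 x) x + t * rip (c%:C *: Q2 x) x.
    by rewrite !ripZl; ring.
  have cV0 : 0 <= c^-1 by rewrite invr_ge0 ltW.
  have cc : (c^-1)%:C * c%:C = 1 :> R[i] by rewrite -rmorphM mulVf ?gt_eqF.
  have pow T : posop T -> posop (op_pow T (-1)) by move=> pT; apply: posop_pow => //; lra.
  have lin T : posop T -> linear (fun x => (c^-1)%:C *: op_pow T (-1) x).
    by move=> pT l u v; rewrite (posop_linear _ (pow _ pT)) scalerDr !scalerA (mulrC l).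
  have sym T : posop T -> isym (fun x => (c^-1)%:C *: op_pow T (-1) x).
    by move=> pT u v; rewrite !ripE (posop_sym _ (pow _ pT)).
  have pos T : posop T -> forall x, 0 <= rip ((c^-1)%:C *: op_pow T (-1) x) x.
    by move=> pT u; rewrite ripZl mulr_ge0// posop_ge0//; exact: pow.
  have inv T : posop T -> forall x, (c^-1)%:C *: op_pow T (-1) (c%:C *: T x) = x.
    move=> pT u; rewrite (linZ _ (posop_linear _ (pow _ pT))) scalerA cc scale1r.
    exact: op_pow_inv.
  pose U T x := (c^-1)%:C *: op_pow T (-1) x.
  have h := inverse_convex t (op_pow P (-1)) (U Q1) (U Q2) P (fun x => c%:C *: Q1 x)
    (fun x => c%:C *: Q2 x) t01 (lin _ pQ1) (sym _ pQ1) (pos _ pQ1)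
    (lin _ pQ2) (sym _ pQ2) (pos _ pQ2) (fun u => op_pow_inv _ u pP) (inv _ pQ1) (inv _ pQ2).
  apply: h => u; rewrite /U !ripZl -(ler_pM2l c0); apply: le_trans (hyp u).
  by rewrite le_eqVlt; apply/orP; left; apply/eqP; field; rewrite gt_eqF.
have cr0 : 0 < c `^ r by exact: powR_gt0.
have [a [b [a0 ab wP]]] := pP.
have [a1 [b1 [a10 ab1 wQ1]]] := pQ1; have [a2 [b2 [a20 ab2 wQ2]]] := pQ2.
have [bP sP _ _] := wP; have [bQ1 sQ1 _ _] := wQ1; have [bQ2 sQ2 _ _] := wQ2.
(* One interval containing the spectra of [P], [c Q1] and [c Q2], so that one resolvent sum serves
   all three. *)
pose lo := Num.min a (c * Num.min a1 a2); pose hi := Num.max b (c * Num.max b1 b2).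
have lo0 : 0 < lo by rewrite !lt_min a0 mulr_gt0// lt_min a10.
have lohi : lo <= hi by rewrite /lo /hi ge_min le_max ab.
have rr : -1 <= r <= 1 by apply/andP; split; lra.
rewrite leNgt; apply/negP => lt_.
set rhs := c `^ r * _ in lt_; set n2 := nrm x ^+ 2.
(* The approximation costs [e |x|^2] at [P] and [e |x|^2] at the weighted pair, less than the gap
   [4 e (|x|^2 + 1)]. *)
have n0 : 0 < 4 * (n2 + 1) by rewrite mulr_gt0// ltr_wpDl// sqr_ge0.
have e0 : 0 < (rip (op_pow P r x) x - rhs) / (4 * (n2 + 1)) by rewrite divr_gt0 ?subr_gt0.
set e := _ / _ in e0.
have eE : e * (4 * (n2 + 1)) = rip (op_pow P r x) x - rhs by rewrite divfK// gt_eqF.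
clearbody e.
have [n [k [s [k0 s0 H0]]]] :=
  powR_resolvent_approx r lo hi e (introT andP (conj r0 r1)) lo0 lohi e0.
have [X [X1 [X2 [hX hX1 hX2 hx]]]] := concave_at_sum n k s k0 s0.
set g := fun v : R => \sum_(0 <= i < n) k i * (v / (v + s i)) in hX hX1 hX2.
have hP u : spectrum P u%:C -> `|u `^ r - g u| <= e.
  move=> /(spectrum_within _ _ _ _ wP)/andP[au ub]; apply: H0.
  by rewrite /lo /hi ge_min au le_max ub.
have hQ T d1 d2 : within d1 d2 T -> 0 < d1 -> Num.min a1 a2 <= d1 -> d2 <= Num.max b1 b2 ->
    forall u, spectrum T u%:C -> g (c * u) <= c `^ r * u `^ r + e.
  move=> wT d10 h1 h2 u /(spectrum_within _ _ _ _ wT)/andP[au ub].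
  have u0 : 0 < u by exact: lt_le_trans au.
  rewrite -powRM ?(ltW c0) ?(ltW u0)//.
  have : `|(c * u) `^ r - g (c * u)| <= e.
    apply: H0; rewrite /lo /hi ge_min le_max !ler_pM2l//.
    by rewrite (le_trans h1 au) (le_trans ub h2) !orbT.
  by rewrite ler_norml => /andP[]; lra.
have calc1 T d1 d2 Z : within d1 d2 T -> 0 < d1 -> d1 <= d2 -> Num.min a1 a2 <= d1 ->
    d2 <= Num.max b1 b2 -> is_fun_calc (fun v : R => g (c * v)) T Z ->
    rip (Z x) x <= c `^ r * rip (op_pow T r x) x + e * n2.
  move=> wT d10 d12 h1 h2 hZ; have [bT sT _ _] := wT.
  have c1 := is_fun_calcD _ _ _ _ _ (is_fun_calcM _ _ _ _ _ _ _ wT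
    (is_fun_calc_cst (c `^ r) T) (op_powP _ _ r _ d10 d12 wT rr)) (is_fun_calc_cst e T).
  have := is_fun_calc_le _ _ _ _ _ bT sT hZ c1 (hQ _ _ _ wT d10 h1 h2) x.
  by rewrite /scalar_op/= ripDl !ripZl rip_nrm.
have [m1 m2] : Num.min a1 a2 <= a1 /\ Num.min a1 a2 <= a2 by rewrite !ge_min !lexx orbT.
have [M1 M2] : b1 <= Num.max b1 b2 /\ b2 <= Num.max b1 b2 by rewrite !le_max !lexx orbT.
have k1 := calc1 _ _ _ _ wQ1 a10 ab1 m1 M1 hX1.
have k2 := calc1 _ _ _ _ wQ2 a20 ab2 m2 M2 hX2.
have k3 : rip (op_pow P r x) x <= rip (X x) x + e * n2.
  have c1 := is_fun_calcD _ _ _ _ _ hX (is_fun_calc_cst e P).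
  have := is_fun_calc_le _ _ _ _ _ bP sP (op_powP _ _ r _ a0 ab wP rr) c1 _ x.
  rewrite /scalar_op/= ripDl ripZl rip_nrm; apply => u /hP.
  by rewrite ler_norml => /andP[]; lra.
have /andP[t0 t1] := t01; have t1' : 0 <= 1 - t by rewrite subr_ge0.
have := ler_wpM2l t0 k2; have := ler_wpM2l t1' k1; have := hx x.
rewrite /rhs in lt_ eE; lra.
Qed.

End Concavity.


(** * The spectral geometric mean *)

(** Polarisation: the form is real at [x], [y] and [x + 'i *: y], and the cross terms at the last
    point are exactly the symmetry defect. *)
Lemma real_form_isym T : linear T -> (forall x, complex.Im (ip (T x) x) = 0) -> isym T.
Proof.
move=> lT T0 x y.
have T0l z : rip ('i *: T z) z = 0 by rewrite rip_il T0 oppr0.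
have T0r z : rip (T z) ('i *: z) = 0 by rewrite rip_ir T0.
have ii z : 'i *: ('i *: z) = - z :> H by rewrite scalerA -expr2 sqr_i scaleN1r.
have ripii u v : rip ('i *: u) ('i *: v) = rip u v.
  by rewrite rip_ir ipZl mulrC ImiRe.
have := T0r (x + 'i *: y); rewrite (linD _ lT) (linZ _ lT) (scalerDr 'i x ('i *: y)) ii.
by rewrite !ripDl !ripDr !ripNr ripii T0l T0r (ripC x); lra.
Qed.

Lemma op_le_isym S T : linear S -> linear T -> isym S -> op_le ip S T -> isym T.
Proof.
move=> lS lT sS ST x y.
have lD : linear (fun x => T x - S x) by move=> k u v; rewrite lS lT scalerBr opprD addrACA.
have := real_form_isym _ lD (fun x => ger0_Im (ST x)) x y.
by rewrite ripBl ripBr (sS x y); lra.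
Qed.

Lemma op_le_qle S T : op_le ip S T -> qle S T.
Proof.
by move=> ST x; have := ST x; rewrite lecE => /andP[_]; rewrite -/(rip _ _) ripBl subr_ge0.
Qed.

Lemma qle_op_le S T : linear S -> linear T -> isym S -> isym T -> qle S T -> op_le ip S T.
Proof.
move=> lS lT sS sT ST x; rewrite lecE -/(rip _ _) ripBl subr_ge0 ST andbT.
have lD : linear (fun x => T x - S x) by move=> k u v; rewrite lS lT scalerBr opprD addrACA.
have sD : isym (fun x => T x - S x) by move=> u v; rewrite ripBl ripBr sT sS.
by have /eqP := rip_i_self _ x lD sD; rewrite rip_il oppr_eq0 eq_sym.
Qed.

Lemma op_le_within m M A : bounded_op A -> op_le ip (scalar_op m) A ->
  op_le ip A (scalar_op M) -> within m M A.
Proof.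
move=> bA mA AM; have [lA _] := bA; split => //.
- apply: (op_le_isym (scalar_op m)) => //; last by move=> x y; rewrite /scalar_op !ripE.
  by move=> k x y; rewrite /scalar_op scalerDr !scalerA mulrC.
- by move=> x; have := op_le_qle _ _ mA x; rewrite /scalar_op ripZl rip_nrm.
- by move=> x; have := op_le_qle _ _ AM x; rewrite /scalar_op ripZl rip_nrm.
Qed.

Lemma posop_gmean A B : posop A -> posop B -> posop (gmean A B).
Proof.
move=> pA pB; rewrite /gmean; apply: posop_sandwich; last by apply: posop_pow => //; lra.
apply: posop_pow; last by lra.
by apply: posop_sandwich => //; apply: posop_pow => //; lra.
Qed.

Lemma gmean_riccati A B x : posop A -> posop B ->
  gmean (op_inv A) B (A (gmean (op_inv A) B x)) = B x.
Proof.
move=> pA pB; rewrite op_invE//; set D := op_pow A (-1).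
(* With [A = D^-1] the inner factors [D^(1/2) D^-1 D^(1/2)] cancel, the two roots of [N] multiply to
   [N], and the outer powers of [D] leave [B]. *)
have pD : posop D by apply: posop_pow => //; lra.
have -> : A = op_pow D (-1) by rewrite /D op_powN1N1.
rewrite /gmean/=; set N := _ \o B \o _.
have pN : posop N by apply: posop_sandwich => //; apply: posop_pow => //; lra.
have add := fun r s y h1 h2 h3 => op_pow_add r s D y pD h1 h2 h3.
rewrite (add (-1) (1 / 2)); [|lra..].
rewrite (add (1 / 2)); [|lra..].
rewrite (_ : 1 / 2 + (-1 + 1 / 2) = 0); last by field.
rewrite op_pow0// (op_pow_add (1 / 2) (1 / 2) N)//; [|lra..].
rewrite (_ : 1 / 2 + 1 / 2 = 1); last by field.
rewrite op_pow1// /N/=.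
rewrite (add (1 / 2) (- (1 / 2))); [|lra..].
rewrite (add (- (1 / 2)) (1 / 2)); [|lra..].
by rewrite subrr addNr !op_pow0.
Qed.

Lemma posop_spectral_gmean t A B : 0 <= t <= 1 -> posop A -> posop B ->
  posop (spectral_gmean t A B).
Proof.
move=> /andP[t0 t1] pA pB; apply: posop_sandwich => //; apply: posop_pow; last by lra.
by apply: posop_gmean => //; rewrite op_invE//; apply: posop_pow => //; lra.
Qed.

Section SpectralMean.
Variables (t m M : R) (A B : H -> H).
Hypotheses (t01 : 0 <= t <= 1) (m0 : 0 < m) (mM : m <= M).
Hypotheses (wA : within m M A) (wB : within m M B).

Let G := gmean (op_inv A) B.
Let M0 : 0 < M. Proof. exact: lt_le_trans mM. Qed.
Let pA : posop A. Proof. by exists m, M. Qed.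
Let pB : posop B. Proof. by exists m, M. Qed.
Let posI T : posop T -> posop (op_pow T (-1)).
Proof. by move=> pT; apply: posop_pow => //; lra. Qed.
Let pG : posop G. Proof. by apply: posop_gmean => //; rewrite op_invE//; exact: posI. Qed.
Let GAG x : G (A (G x)) = B x. Proof. exact: gmean_riccati. Qed.
Let pS := posop_spectral_gmean t A B t01 pA pB.
Let tt : -1 <= t <= 1. Proof. by move: t01 => /andP[t0 t1]; lra. Qed.
Let ttN : -1 <= - t <= 1. Proof. by move: t01 => /andP[t0 t1]; lra. Qed.

(** The congruence bound with [P = A], [Q = B = G A G], [F' = G^-1], [Y = G^t]. *)
Lemma le_spectral_gmean x :
  (1 - t) * rip (A x) x + t * rip (B x) x
    <= kantorovich_const m M * rip (spectral_gmean t A B x) x.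
Proof.
have sY := posop_sym _ (posop_pow t _ pG tt).
rewrite /spectral_gmean/= sY.
apply: (kantorovich_congruence t m M A B (op_pow G (-1))) => //.
- exact: posop_linear (posI _ pG).
- exact: posop_sym (posI _ pG).
- move=> y; set z := RHS; have -> : y = B z; last exact: op_pow_inv.
  by rewrite -GAG /z !op_pow_invr.
- by move=> y; exact: young_form.
Qed.

(** The dual choice [P = A^-1], [Q = B^-1 = G^-1 A^-1 G^-1], [F' = G], [Y = G^-t], over
    [[M^-1, m^-1]], whose Kantorovich constant is the same. *)
Lemma spectral_gmean_inv_ge x :
  (1 - t) * rip (op_pow A (-1) x) x + t * rip (op_pow B (-1) x) x
    <= kantorovich_const m M * rip (op_pow (spectral_gmean t A B) (-1) x) x.
Proof.
have Y_sym := posop_sym _ (posop_pow (- t) _ pG ttN).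
have -> : op_pow (spectral_gmean t A B) (-1) x =
    op_pow G (- t) (op_pow A (-1) (op_pow G (- t) x)).
  set z := RHS; have -> : x = spectral_gmean t A B z; last exact: op_pow_inv.
  rewrite /z /spectral_gmean/= -/G.
  have c1 y : op_pow G t (op_pow G (- t) y) = y.
    by rewrite -{1}[t]opprK op_pow_cancel.
  by rewrite c1 op_pow_invr// c1.
rewrite Y_sym.
have wI T : within m M T -> within (M^-1) (m^-1) (op_pow T (-1)).
  move=> wT; have h01 : 0 <= (1 : R) <= 1 by apply/andP; split; [exact: ler01 | exact: lexx].
  have := op_powN_within _ _ _ _ m0 mM wT h01.
  by rewrite (powR_inv1 (ltW m0)) (powR_inv1 (ltW M0)).
have -> : kantorovich_const m M = kantorovich_const M^-1 m^-1.
  by rewrite /kantorovich_const; field; rewrite !gt_eqF// addr_gt0.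
apply: (kantorovich_congruence t _ _ _ (op_pow B (-1)) G) => //.
- by rewrite invr_gt0.
- by rewrite lef_pV2 ?posrE.
- exact: wI.
- exact: wI.
- exact: posop_linear pG.
- exact: posop_sym pG.
- by move=> y; rewrite !op_powN1N1.
- by move=> y; exact: youngN_form.
Qed.

End SpectralMean.

Lemma spectral_gmean_pow_le t m M r A B : 0 <= t <= 1 -> 0 < m -> m <= M -> 0 <= r <= 1 ->
  within m M A -> within m M B ->
  forall x, rip (op_pow (spectral_gmean t A B) r x) x <=
    kantorovich_const m M `^ r * kantorovich_const (m `^ r) (M `^ r) *
    rip (spectral_gmean t (op_pow A r) (op_pow B r) x) x.
Proof.
move=> t01 m0 mM r01 wA wB x; have M0 : 0 < M by exact: lt_le_trans mM.
have pA : posop A by exists m, M.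
have pB : posop B by exists m, M.
have C0 : 0 < kantorovich_const m M.
  by rewrite (lt_le_trans ltr01)// kantorovich_const_ge1.
have h := powR_monotone_concave t _ _ _ _ t01 C0 (posop_spectral_gmean _ _ _ t01 pA pB) pA pB
  (spectral_gmean_inv_ge t m M A B t01 m0 mM wA wB) r x r01.
rewrite (le_trans h)// -mulrA ler_wpM2l ?powR_ge0//.
apply: le_spectral_gmean => //; first exact: powR_gt0.
- by case/andP: r01 => r0 _; rewrite ge0_ler_powR// nnegrE ltW.
- exact: op_pow_within.
- exact: op_pow_within.
Qed.

End RealInnerProduct.

Theorem theorem2p5 (R : realType)
    (H : completeNormedModType R[i]) (ip : {dot H for Num.conj})
    (ip_norm : forall x : H, ip x x = `|x| ^+ 2)
    (A B : H -> H) (bA : bounded_op A) (bB : bounded_op B)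
    (m M : R) (m_gt0 : 0 < m)
    (mA : op_le ip (scalar_op m) A) (AM : op_le ip A (scalar_op M))
    (mB : op_le ip (scalar_op m) B) (BM : op_le ip B (scalar_op M))
    (r t lam : R) (r01 : 0 <= r <= 1) (t01 : 0 <= t <= 1)
    (lamE : lam = Num.min t (1 - t)) :
  op_le ip
    (op_pow (spectral_gmean t A B) r)
    (scalar_op (Num.min (kappa1 m M r t lam) (kappa2 m M r t lam))
       \o spectral_gmean t (op_pow A r) (op_pow B r)).
Proof.
have wA := op_le_within _ ip_norm _ _ _ bA mA AM.
have wB := op_le_within _ ip_norm _ _ _ bB mB BM.
(* The bounds on [A] yield [m <= M] only through a nonzero vector; on the zero space the claim is
   trivial. *)
have [[z z0]|all0] := pselect (exists x : H, x <> 0); last first.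
  move=> x; have -> : x = 0 by apply: contrapT => x0; apply: all0; exists x.
  by rewrite linear0r.
have mM : m <= M.
  have [_ _ lo hi] := wA; have := le_trans (lo z) (hi z).
  rewrite ler_pM2r// exprn_gt0// lt_def nrm_ge0 andbT.
  by apply/eqP => /nrm_eq0.
have pA : posop ip A by exists m, M.
have pB : posop ip B by exists m, M.
have rr : -1 <= r <= 1 by case/andP: r01 => r0 r1; lra.
have pS := posop_spectral_gmean _ ip_norm _ _ _ t01 pA pB.
have pL := posop_pow _ ip_norm _ _ pS rr.
have pR := posop_spectral_gmean _ ip_norm _ _ _ t01
  (posop_pow _ ip_norm _ _ pA rr) (posop_pow _ ip_norm _ _ pB rr).
apply: qle_op_le.
- exact: posop_linear pL.
- by move=> k x y; rewrite /scalar_op/= (posop_linear _ _ pR) scalerDr !scalerA mulrC.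
- exact: posop_sym pL.
- by move=> x y; rewrite /scalar_op/= ripZl ripZr (posop_sym _ _ pR).
- move=> x; rewrite /scalar_op/= ripZl.
  rewrite (le_trans (spectral_gmean_pow_le _ ip_norm _ _ _ _ _ _ t01 m_gt0 mM r01 wA wB x))//.
  by rewrite ler_wpM2r ?(posop_ge0 _ _ _ pR)// kantorovich_const_le_kappa.
Qed.
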